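(* Let $X$ be a compact metric space and let $n\ge 1$ be an integer. For any $\epsilon>0$ and any finite subset $\mathcal F\subset C(X)$, there exist a finite subset $\mathcal G\subset C(X)$ and $\delta>0$ satisfying the following: Suppose that $\phi: C(X)\to C([0,1],M_n)$ is a unital homomorphism and $u\in C([0,1],M_n)$ is a unitary such that $$\|u\phi(g)-\phi(g)u\|<\delta\quad\text{for all } g\in\mathcal G.$$ Then there exists a continuous path of unitaries $\{U(s): s\in[0,1]\}$ in $C([0,1],M_n)$ with $U(0)=u$ and $U(1)=1$ such that $$\|U(s)\phi(f)-\phi(f)U(s)\|<\epsilon\quad\text{for all } f\in\mathcal F\text{ and all } s\in[0,1].$$ Moreover, if $u(0)(\pi_0\circ\phi(f))=(\pi_0\circ\phi(f))u(0)$ (and $u(1)(\pi_1\circ\phi(f))=(\pi_1\circ\phi(f))u(1)$) for all $f\in C(X)$, then one can choose $U$ so that $U(s)(0)(\pi_0\circ\phi(f))=(\pi_0\circ\phi(f))U(s)(0)$ (and $U(s)(1)(\pi_1\circ\phi(f))=(\pi_1\circ\phi(f))U(s)(1)$, respectively) for all $f\in C(X)$ and all $s\in[0,1]$.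
   Context: $M_n$ is the algebra of $n\times n$ complex matrices; homomorphisms are $*$-homomorphisms. For $t\in[0,1]$, $\pi_t: C([0,1],M_n)\to M_n$ denotes the point evaluation $\pi_t(f)=f(t)$. *)

(* Defs.v *)
From HB Require Import structures.
From mathcomp Require Import all_boot all_order all_algebra.
From mathcomp Require Import spectral complex.
From mathcomp Require Import all_classical all_reals all_analysis.
Set Implicit Arguments.
Unset Strict Implicit.
Unset Printing Implicit Defensive.
Import Order.TTheory GRing.Theory Num.Theory.
Import numFieldNormedType.Exports.
Local Open Scope classical_set_scope.
Local Open Scope ring_scope.
Local Open Scope complex_scope.
Local Open Scope sesquilinear_scope.

(* The regular alias [^o] is what carries the norm topology on [R[i]]. *)
Notation Cplx R := (R[i]^o).

(* As a type of its own, with the topology induced from [R]. *)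
Notation unit_itv R := (set_type `[0 : R, 1]%classic).

Lemma mem0_unit_itv (R : realType) : (0 : R) \in `[0 : R, 1]%classic.
Proof. by rewrite inE /= in_itv /= lexx ler01. Qed.

Lemma mem1_unit_itv (R : realType) : (1 : R) \in `[0 : R, 1]%classic.
Proof. by rewrite inE /= in_itv /= lexx ler01. Qed.

Definition itv0 (R : realType) : unit_itv R := SigSub (mem0_unit_itv R).
Definition itv1 (R : realType) : unit_itv R := SigSub (mem1_unit_itv R).

Section CX.
Variables (R : realType) (X : topologicalType).

Definition CX : Type := continuousType X (Cplx R).

Lemma CX_add_continuous (f g : CX) : continuous (fun x => f x + g x).
Proof.
by move=> x; apply: cvgD; [exact: (@cts_fun _ _ f) | exact: (@cts_fun _ _ g)].
Qed.

Lemma CX_mul_continuous (f g : CX) : continuous (fun x => f x * g x).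
Proof.
move=> x; apply: (@cvgZ _ (Cplx R)); last exact: (@cts_fun _ _ g).
exact: (@cts_fun _ _ f).
Qed.

Lemma CX_scale_continuous (a : Cplx R) (f : CX) : continuous (fun x => a * f x).
Proof.
move=> x; apply: (@cvgZ _ (Cplx R)); first exact: cvg_cst.
exact: (@cts_fun _ _ f).
Qed.

Lemma CX_conj_continuous (f : CX) : continuous (fun x => (f x)^* : Cplx R).
Proof.
move=> x; apply/cvgrPdist_lt => e e0.
have /cvgrPdist_lt /(_ e e0) := @cts_fun _ _ f x.
by apply: filterS => y; rewrite -rmorphB norm_conjC.
Qed.

Definition CX_add (f g : CX) : CX := mkcts (@CX_add_continuous f g).
Definition CX_mul (f g : CX) : CX := mkcts (@CX_mul_continuous f g).
Definition CX_scale (a : Cplx R) (f : CX) : CX := mkcts (@CX_scale_continuous a f).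
Definition CX_conj (f : CX) : CX := mkcts (@CX_conj_continuous f).
Definition CX_one : CX := cst (1 : Cplx R).

End CX.

Section CIM.
Variables (R : realType) (n : nat).

Definition l2norm (v : 'cV[Cplx R]_n) : R :=
  Num.sqrt (\sum_(i < n) (ComplexField.Normc.normc (v i 0)) ^+ 2).

(* The C*-norm of M_n: the operator norm for the Euclidean norm on C^n. *)
Definition opnorm (A : 'M[Cplx R]_n) : R :=
  sup [set l2norm (A *m v) | v in [set v | l2norm v <= 1]].

(* C([0,1], M_n); the library's topology on matrices is the entrywise one,
   which is the norm topology in finite dimension. *)
Definition CIM : Type := continuousType (unit_itv R) 'M[Cplx R]_n.

Definition supnorm (a : unit_itv R -> 'M[Cplx R]_n) : R :=
  sup (range (fun t => opnorm (a t))).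

Definition commf (a b : CIM) : unit_itv R -> 'M[Cplx R]_n :=
  fun t => a t *m b t - b t *m a t.

Definition unitary_fun (u : CIM) : Prop := forall t, u t \is unitarymx.

(* The operations of C([0,1], M_n) are pointwise. *)
Record unital_star_hom (X : topologicalType) (phi : CX R X -> CIM) : Prop := {
  hom_add : forall f g t, phi (CX_add f g) t = phi f t + phi g t;
  hom_scale : forall a f t, phi (CX_scale a f) t = a *: phi f t;
  hom_mul : forall f g t, phi (CX_mul f g) t = phi f t *m phi g t;
  hom_star : forall f t, phi (CX_conj f) t = (phi f t)^t*;
  hom_one : forall t, phi (CX_one R X) t = 1%:M
}.

Definition norm_cts_path (U : unit_itv R -> CIM) : Prop :=
  forall s (e : R), 0 < e ->
    \forall s' \near s, supnorm (fun t => U s' t - U s t) < e.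

End CIM.

Arguments unitary_fun : clear implicits.
Arguments unitary_fun {R n} u.
Arguments norm_cts_path : clear implicits.
Arguments norm_cts_path {R n} U.

(* Main.v *)
Require Import Defs.
From HB Require Import structures.
From mathcomp Require Import all_boot all_order all_algebra.
From mathcomp Require Import spectral complex.
From mathcomp Require Import all_classical all_reals all_analysis.
From mathcomp Require Import ring lra.
Set Implicit Arguments.
Unset Strict Implicit.
Unset Printing Implicit Defensive.
Import Order.TTheory GRing.Theory Num.Theory.
Import numFieldNormedType.Exports.
Local Open Scope classical_set_scope.
Local Open Scope ring_scope.

(* Since all [phi t f] with [t] fixed commute and are normal, they are
   simultaneously diagonal.  If [u t] almost commutes with them, then clustering
   the joint spectrum of [phi t] and cutting a branch of [log (u t)] down to the
   clusters yields an orthonormal basis [W] that almost diagonalizes [u t] and all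
   [phi t f]; so [u t] is close to [exp (i a)], with [a] real and diagonal in [W],
   and [r |-> exp (i r a)] leads from (almost) [u t] to [1].

   The interval is cut into short pieces and this is done at each node.  Two
   neighbouring nodes carry almost diagonalizing bases [W] and [W'] of nearly the
   same matrices.  The [2 n] arguments leave a gap on the circle, and for the
   branch of the logarithm cut in this gap both exponentials are uniformly close.
   What remains are loops [exp (2 pi i m r p)], with [m] an integer and [p] the
   projection onto a vector of [W].  These may wind arbitrarily often, but their
   commutators are bounded independently of [m].  A vector of [W] and a vector of
   [W'] that are not almost orthogonal are almost eigenvectors for almost the same
   joint eigenvalue, so the first can be turned into the second through such
   vectors.  This moves every loop to [W'], which determines the branch to be used
   at the next node; the errors do not accumulate, because each node starts again
   from an exact diagonal form. *)

Local Open Scope complex_scope.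
Local Open Scope sesquilinear_scope.

(** The obstacle is the order of choices: [delta] is fixed before [phi] and [u], whereas the number
    of nodes depends on their moduli of continuity. So every constant may depend on [n] and [eps]
    alone, never on the number of nodes or on the turns collected on the way. A logarithm of [u]
    cannot simply be continued along the interval, because the branch at a node may drift by more
    and more multiples of [2 pi].

    What is already close to 1 is contracted to 1 by a rational function of Cayley type instead of a
    logarithm: unitarity, continuity and the commutator bound then follow from algebraic identities
    and a bound on one inverse.

    The conditions at the two ends are exact, so at a node where [u] commutes with all values of
    [phi] the diagonalization is exact too; the contracted factor is then 1, and the path there is
    [exp (i r a)] itself.

    Estimates use the sum of the moduli of the entries, which sees Schur multipliers directly;
    unitaries are then bounded by [unK] rather than by 1, and powers of [K] record each
    multiplication by a unitary. *)

Notation nc := ComplexField.Normc.normc.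

(** * The modulus of a complex number, as a real number *)

Section Modulus.
Variable R : realType.
Implicit Types z : R[i].

Lemma nc_norm z : (nc z)%:C = `|z|.
Proof. by rewrite normc_def; case: z. Qed.

Lemma nc_ge0 z : 0 <= nc z.
Proof. by case: z => a b; exact: sqrtr_ge0. Qed.

Lemma ncM z w : nc (z * w) = nc z * nc w.
Proof. exact: ComplexField.Normc.normcM. Qed.

Lemma ncD z w : nc (z + w) <= nc z + nc w.
Proof. by have := ler_normD z w; rewrite -!nc_norm -rmorphD lecR. Qed.

Lemma ncN z : nc (- z) = nc z.
Proof. by apply: complexI; rewrite !nc_norm normrN. Qed.

Lemma ncJ z : nc (z^*)%R = nc z.
Proof. by apply: complexI; rewrite !nc_norm norm_conjC. Qed.

Lemma nc0 : nc (0 : R[i]) = 0.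
Proof. by apply: complexI; rewrite nc_norm normr0. Qed.

Lemma nc1 : nc (1 : R[i]) = 1.
Proof. by apply: complexI; rewrite nc_norm normr1. Qed.

Lemma nc_real (a : R) : nc a%:C = `|a|.
Proof. by rewrite /= expr0n /= addr0 sqrtr_sqr. Qed.

Lemma nc_realB (a b : R) : nc (a%:C - b%:C) = `|a - b|.
Proof. by rewrite -nc_real rmorphB. Qed.

Lemma nc_eq0 z : (nc z == 0) = (z == 0).
Proof. by rewrite -(inj_eq (@complexI R)) nc_norm normr_eq0. Qed.

Lemma nc_sqr z : ((nc z) ^+ 2)%:C = z * (z^*)%R.
Proof. by rewrite rmorphXn /= nc_norm normCK. Qed.

Lemma nc_sum I (r : seq I) (P : pred I) (F : I -> R[i]) :
  nc (\sum_(i <- r | P i) F i) <= \sum_(i <- r | P i) nc (F i).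
Proof.
elim/big_rec2: _ => [|i y x _ h]; first by rewrite nc0.
by apply: le_trans (ncD _ _) _; rewrite lerD2l.
Qed.

End Modulus.

(** * A submultiplicative norm on matrices *)

HB.lock Definition nrm (R : realType) (m n : nat) (A : 'M[R[i]]_(m, n)) : R :=
  \sum_i \sum_j nc (A i j).

(* A common bound for [nrm 1%:M] and for the norms of unitary matrices; the
   successor makes it at least [1] also in dimension [0]. *)
HB.lock Definition unK (R : realType) (n : nat) : R := (n.+1 ^ 2)%:R.

Section Norm.
Variable R : realType.
Implicit Types m n p : nat.

Lemma nrm_ge0 m n (A : 'M[R[i]]_(m, n)) : 0 <= nrm A.
Proof. by rewrite nrm.unlock; apply: sumr_ge0 => i _; apply: sumr_ge0 => j _; exact: nc_ge0. Qed.

Lemma nrm0 m n : nrm (0 : 'M[R[i]]_(m, n)) = 0.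
Proof. by rewrite nrm.unlock; apply: big1 => i _; apply: big1 => j _; rewrite mxE nc0. Qed.

Lemma entry_le_nrm m n (A : 'M[R[i]]_(m, n)) i j : nc (A i j) <= nrm A.
Proof.
rewrite nrm.unlock (bigD1 i) //= (bigD1 j) //= -addrA lerDl.
apply: addr_ge0; first by apply: sumr_ge0 => ? _; exact: nc_ge0.
by apply: sumr_ge0 => ? _; apply: sumr_ge0 => ? _; exact: nc_ge0.
Qed.

Lemma nrm_eq0 m n (A : 'M[R[i]]_(m, n)) : nrm A <= 0 -> A = 0.
Proof.
move=> h; apply/matrixP => i j; rewrite mxE; apply/eqP; rewrite -nc_eq0.
by rewrite eq_le nc_ge0 andbT (le_trans (entry_le_nrm A i j)).
Qed.

Lemma nrm_le_entries m n (A : 'M[R[i]]_(m, n)) (c : R) :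
  (forall i j, nc (A i j) <= c) -> nrm A <= (m * n)%:R * c.
Proof.
move=> h; rewrite nrm.unlock; apply: (@le_trans _ _ (\sum_(i < m) \sum_(j < n) c)).
  by apply: ler_sum => i _; apply: ler_sum => j _.
by rewrite !sumr_const !card_ord -mulrnA mulnC mulr_natl.
Qed.

Lemma nrmD m n (A B : 'M[R[i]]_(m, n)) : nrm (A + B) <= nrm A + nrm B.
Proof.
rewrite nrm.unlock -big_split /=; apply: ler_sum => i _; rewrite -big_split /=.
by apply: ler_sum => j _; rewrite mxE ncD.
Qed.

Lemma nrmN m n (A : 'M[R[i]]_(m, n)) : nrm (- A) = nrm A.
Proof.
by rewrite nrm.unlock; apply: eq_bigr => i _; apply: eq_bigr => j _; rewrite mxE ncN.
Qed.

Lemma nrmB m n (A B : 'M[R[i]]_(m, n)) : nrm (A - B) <= nrm A + nrm B.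
Proof. by rewrite -(nrmN B) nrmD. Qed.

Lemma nrmC m n (A B : 'M[R[i]]_(m, n)) : nrm (A - B) = nrm (B - A).
Proof. by rewrite -nrmN opprB. Qed.

Lemma nrm_trans m n (B A C : 'M[R[i]]_(m, n)) :
  nrm (A - C) <= nrm (A - B) + nrm (B - C).
Proof.
have -> : A - C = (A - B) + (B - C) by rewrite addrA subrK.
exact: nrmD. Qed.

Lemma nrmZ m n (a : R[i]) (A : 'M[R[i]]_(m, n)) : nrm (a *: A) = nc a * nrm A.
Proof.
rewrite nrm.unlock mulr_sumr; apply: eq_bigr => i _; rewrite mulr_sumr.
by apply: eq_bigr => j _; rewrite mxE ncM.
Qed.

Lemma nrm_tC m n (A : 'M[R[i]]_(m, n)) : nrm (A ^t*) = nrm A.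
Proof.
rewrite nrm.unlock exchange_big; apply: eq_bigr => i _; apply: eq_bigr => j _.
by rewrite !mxE ncJ.
Qed.

Lemma nrmM m n p (A : 'M[R[i]]_(m, n)) (B : 'M[R[i]]_(n, p)) :
  nrm (A *m B) <= nrm A * nrm B.
Proof.
rewrite nrm.unlock mulr_suml; apply: ler_sum => i _.
apply: (@le_trans _ _ (\sum_j \sum_k nc (A i k) * nc (B k j))).
  apply: ler_sum => j _; rewrite mxE; apply: le_trans (nc_sum _ _ _) _.
  by apply: ler_sum => k _; rewrite ncM.
rewrite exchange_big /= mulr_suml; apply: ler_sum => k _; rewrite -mulr_sumr.
apply: ler_wpM2l; first exact: nc_ge0.
rewrite (bigD1 k) //= lerDl; apply: sumr_ge0 => ? _.
by apply: sumr_ge0 => ? _; exact: nc_ge0.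
Qed.

Lemma unK_ge1 n : 1 <= unK R n.
Proof. by rewrite unK.unlock ler1n expn_gt0. Qed.

Lemma unK_ge0 n : 0 <= unK R n.
Proof. exact: le_trans ler01 (unK_ge1 n). Qed.

Lemma nrm_le_unK n (A : 'M[R[i]]_n) c :
  0 <= c -> (forall i j, nc (A i j) <= c) -> nrm A <= unK R n * c.
Proof.
move=> c0 /nrm_le_entries/le_trans; apply; apply: ler_wpM2r => //.
by rewrite unK.unlock ler_nat -mulnn leq_mul.
Qed.

Lemma unitary_entry n (W : 'M[R[i]]_n) i j : W \is unitarymx -> nc (W i j) <= 1.
Proof.
move=> /unitarymxP /matrixP /(_ i i); rewrite !mxE eqxx => h.
have {h} : \sum_k (nc (W i k)) ^+ 2 = 1.
  apply: complexI; rewrite rmorph_sum /= -[RHS]h; apply: eq_bigr => k _.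
  by rewrite nc_sqr !mxE.
rewrite (bigD1 j) //= => h; have : nc (W i j) ^+ 2 <= 1 ^+ 2.
  by rewrite expr1n -h lerDl; apply: sumr_ge0 => ? _; exact: sqr_ge0.
by rewrite ler_sqr // nnegrE // nc_ge0.
Qed.

Lemma nrm_unitary n (W : 'M[R[i]]_n) : W \is unitarymx -> nrm W <= unK R n.
Proof.
by move=> uW; rewrite -[leRHS]mulr1; apply: nrm_le_unK => // i j; exact: unitary_entry.
Qed.

Lemma nrm1 n : nrm (1%:M : 'M[R[i]]_n) <= unK R n.
Proof. by apply: nrm_unitary; apply/unitarymxP; rewrite trmx1 map_mx1 mulmx1. Qed.

Lemma nrm_mulUl n (W A : 'M[R[i]]_n) :
  W \is unitarymx -> nrm (W *m A) <= unK R n * nrm A.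
Proof.
move=> uW; apply: le_trans (nrmM _ _) _; apply: ler_wpM2r; first exact: nrm_ge0.
exact: nrm_unitary.
Qed.

Lemma nrm_mulUr n (W A : 'M[R[i]]_n) :
  W \is unitarymx -> nrm (A *m W) <= unK R n * nrm A.
Proof.
move=> uW; apply: le_trans (nrmM _ _) _; rewrite mulrC.
by apply: ler_wpM2r; [exact: nrm_ge0 | exact: nrm_unitary].
Qed.

Lemma unitary_tC n (W : 'M[R[i]]_n) : W \is unitarymx -> W^t* \is unitarymx.
Proof. by rewrite trmxC_unitary. Qed.

Lemma unitaryVm n (W : 'M[R[i]]_n) : W \is unitarymx -> W ^t* *m W = 1%:M.
Proof. by rewrite -trmxC_unitary => /unitarymxP; rewrite trmxCK. Qed.

Lemma tC_mul m n p (A : 'M[R[i]]_(m, n)) (B : 'M[R[i]]_(n, p)) :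
  (A *m B)^t* = B^t* *m A^t*.
Proof. by rewrite trmx_mul map_mxM. Qed.

Lemma conj_unitaryM n (E A B : 'M[R[i]]_n) : E \is unitarymx ->
  E^t* *m A *m E *m (E^t* *m B *m E) = E^t* *m (A *m B) *m E.
Proof. by move=> uE; rewrite !mulmxA (mulmxtVK _ uE). Qed.

Lemma unitary1 n : (1%:M : 'M[R[i]]_n) \is unitarymx.
Proof. by apply/unitarymxP; rewrite trmx1 map_mx1 mulmx1. Qed.

End Norm.

(** * Continuity measured by the norm *)

Section Continuity.
Variable R : realType.
Implicit Types (T : topologicalType) (m n : nat).

(** Stated through real-valued distances, so that continuity follows from norm estimates by
    squeezing; [mcts_continuous] and [continuous_mcts] return to the entrywise topology. *)
Definition mcts T m n (f : T -> 'M[R[i]]_(m, n)) :=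
  forall p, nrm (f q - f p) @[q --> p] --> (0 : R).

Definition ccts T (f : T -> R[i]) :=
  forall p, nc (f q - f p) @[q --> p] --> (0 : R).

Lemma squeeze0 T (F : set_system T) {FF : Filter F} (h k : T -> R) :
  (forall q, 0 <= h q <= k q) -> k q @[q --> F] --> (0 : R) -> h q @[q --> F] --> (0 : R).
Proof.
by move=> hk k0; apply: (squeeze_cvgr _ (cvg_cst 0) k0); exact: nearW.
Qed.

Lemma mcts_cst T m n (A : 'M[R[i]]_(m, n)) : mcts (fun _ : T => A).
Proof. by move=> p; under eq_fun do rewrite subrr nrm0; exact: cvg_cst. Qed.

Lemma mctsD T m n (f g : T -> 'M[R[i]]_(m, n)) :
  mcts f -> mcts g -> mcts (fun t => f t + g t).
Proof.
move=> cf cg p; apply: (@squeeze0 _ _ _ _ (fun q => nrm (f q - f p) + nrm (g q - g p))).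
  by move=> q; rewrite nrm_ge0 /= opprD addrACA nrmD.
by rewrite -[0]addr0; apply: cvgD; [exact: cf | exact: cg].
Qed.

Lemma mctsN T m n (f : T -> 'M[R[i]]_(m, n)) : mcts f -> mcts (fun t => - f t).
Proof.
move=> cf p; under eq_fun do rewrite -opprD nrmN; exact: cf.
Qed.

Lemma mctsM T m n r (f : T -> 'M[R[i]]_(m, n)) (g : T -> 'M[R[i]]_(n, r)) :
  mcts f -> mcts g -> mcts (fun t => f t *m g t).
Proof.
move=> cf cg p; apply: (@squeeze0 _ _ _ _ (fun q => nrm (f q - f p) *
    (nrm (g q - g p) + nrm (g p)) + nrm (f p) * nrm (g q - g p))).
  move=> q; rewrite nrm_ge0 /=.
  have -> : f q *m g q - f p *m g p =
     (f q - f p) *m ((g q - g p) + g p) + f p *m (g q - g p).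
    by rewrite subrK mulmxBl mulmxBr addrA subrK.
  apply: le_trans (nrmD _ _) _; apply: lerD; last exact: nrmM.
  apply: le_trans (nrmM _ _) _; apply: ler_wpM2l; first exact: nrm_ge0.
  exact: nrmD.
have -> : (0 : R) = 0 * (0 + nrm (g p)) + nrm (f p) * 0 by rewrite mul0r mulr0 addr0.
apply: cvgD; apply: cvgM; try exact: cf; try exact: cg; try exact: cvg_cst.
by apply: cvgD; [exact: cg | exact: cvg_cst].
Qed.

Lemma mcts_tC T m n (f : T -> 'M[R[i]]_(m, n)) : mcts f -> mcts (fun t => (f t)^t*).
Proof.
move=> cf p; have -> : (fun q => nrm ((f q)^t* - (f p)^t*)) = (fun q => nrm (f q - f p)).
  by apply/funext => q; rewrite -[RHS]nrm_tC linearB /= map_mxB.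
exact: cf.
Qed.

Lemma ccts_cst T (a : R[i]) : ccts (fun _ : T => a).
Proof. by move=> p; under eq_fun do rewrite subrr nc0; exact: cvg_cst. Qed.

Lemma mcts_entries T m n (f : T -> 'M[R[i]]_(m, n)) :
  (forall i j, ccts (fun t => f t i j)) -> mcts f.
Proof.
move=> cf p.
have -> : (0 : R) = \sum_(i < m) \sum_(j < n) 0.
  by rewrite big1 // => i _; rewrite big1.
have -> : (fun q => nrm (f q - f p)) = (fun q => \sum_i \sum_j nc ((f q - f p) i j)).
  by rewrite nrm.unlock.
have cD : continuous (fun x : R * R => x.1 + x.2).
  by move=> x; apply: cvgD; [exact: cvg_fst | exact: cvg_snd].
have cS (I : finType) (h : I -> T -> R) (l : I -> R) :
    (forall i, h i q @[q --> p] --> l i) -> \sum_i h i q @[q --> p] --> \sum_i l i.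
  by move=> hl; apply: cvg_big.
apply: (cS _ (fun i q => \sum_j nc ((f q - f p) i j)) (fun=> \sum_(j < n) 0)) => i.
apply: (cS _ (fun j q => nc ((f q - f p) i j)) (fun=> 0)) => j.
have -> : (fun q => nc ((f q - f p) i j)) = (fun q => nc (f q i j - f p i j)).
  by apply/funext => q; rewrite !mxE.
exact: cf.
Qed.

Lemma mctsZ T m n (a : T -> R[i]) (f : T -> 'M[R[i]]_(m, n)) :
  ccts a -> mcts f -> mcts (fun t => a t *: f t).
Proof.
move=> ca cf p; apply: (@squeeze0 _ _ _ _ (fun q => nc (a q - a p) *
    (nrm (f q - f p) + nrm (f p)) + nc (a p) * nrm (f q - f p))).
  move=> q; rewrite nrm_ge0 /=.
  have -> : a q *: f q - a p *: f p =
     (a q - a p) *: ((f q - f p) + f p) + a p *: (f q - f p).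
    by rewrite subrK scalerBl scalerBr addrA subrK.
  apply: le_trans (nrmD _ _) _; rewrite !nrmZ lerD2r.
  by apply: ler_wpM2l; [exact: nc_ge0 | exact: nrmD].
have -> : (0 : R) = 0 * (0 + nrm (f p)) + nc (a p) * 0 by rewrite mul0r mulr0 addr0.
apply: cvgD; apply: cvgM; try exact: cf; try exact: ca; try exact: cvg_cst.
by apply: cvgD; [exact: cf | exact: cvg_cst].
Qed.

Lemma mcts_comp T T' m n (f : T -> 'M[R[i]]_(m, n)) (h : T' -> T) :
  continuous h -> mcts f -> mcts (f \o h).
Proof.
move=> ch cf p; apply: (@cvg_comp _ _ _ h (fun q => nrm (f q - f (h p)))); first exact: ch.
exact: cf.
Qed.

(** Resolvent identity: a difference of inverses is the difference of the matrices between two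
    uniformly bounded factors. *)
Lemma mcts_inv T n (f : T -> 'M[R[i]]_n) (c : R) :
  (forall t, f t \in unitmx) -> (forall t, nrm (invmx (f t)) <= c) ->
  mcts f -> mcts (fun t => invmx (f t)).
Proof.
move=> uf bf cf p; apply: (@squeeze0 _ _ _ _ (fun q => c * nrm (f q - f p) * c)).
  move=> q; rewrite nrm_ge0 /=.
  have -> : invmx (f q) - invmx (f p) = - (invmx (f q) *m (f q - f p) *m invmx (f p)).
    by rewrite mulmxBr mulmxBl mulVmx // -[_ *m f p *m _]mulmxA mulmxV // mul1mx mulmx1 opprB.
  have c0 : 0 <= c by apply: le_trans (bf q); exact: nrm_ge0.
  rewrite nrmN; apply: le_trans (nrmM _ _) _; apply: ler_pM => //; try exact: nrm_ge0.
  by apply: le_trans (nrmM _ _) _; apply: ler_wpM2r => //; exact: nrm_ge0.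
have -> : (0 : R) = c * 0 * c by rewrite mulr0 mul0r.
by apply: cvgM; last exact: cvg_cst; apply: cvgM; [exact: cvg_cst | exact: cf].
Qed.

Lemma cctsD T (f g : T -> R[i]) : ccts f -> ccts g -> ccts (fun t => f t + g t).
Proof.
move=> cf cg p; apply: (@squeeze0 _ _ _ _ (fun q => nc (f q - f p) + nc (g q - g p))).
  by move=> q; rewrite nc_ge0 /= opprD addrACA ncD.
by rewrite -[0]addr0; apply: cvgD; [exact: cf | exact: cg].
Qed.

Lemma ccts_ReIm T (f g : T -> R) :
  continuous f -> continuous g -> ccts (fun t => (f t +i* g t)).
Proof.
move=> cf cg p; apply: (@squeeze0 _ _ _ _ (fun q => `|f q - f p| + `|g q - g p|)).
  move=> q; rewrite nc_ge0 /=.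
  apply: (@le_trans _ _ (Num.sqrt ((`|f q - f p| + `|g q - g p|)^+2))).
    apply: ler_wsqrtr; set x := f q - f p; set y := g q - g p.
    rewrite [leRHS]sqrrD !real_normK ?num_real //.
    by rewrite lerD2r lerDl mulrn_wge0 // mulr_ge0.
  by rewrite sqrtr_sqr ger0_norm // addr_ge0.
have -> : (0 : R) = `|f p - f p| + `|g p - g p| by rewrite !subrr normr0 addr0.
apply: cvgD; apply: cvg_norm; apply: cvgB; try exact: cvg_cst; [exact: cf|exact: cg].
Qed.

End Continuity.

(** * The unit circle and branches of the argument *)

HB.lock Definition cis (R : realType) (a : R) : R[i] := cos a +i* sin a.

Definition gap (R : realType) (N : nat) : R := pi / N.+1%:R.

(** A Lipschitz constant for the argument on angles at most [2 pi - 2 * gap] apart, as [cis_lower]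
    shows; the square comes from [sin_lower]. *)
HB.lock Definition gapC (R : realType) (N : nat) : R := (sin (gap R N / 2) ^+ 2)^-1.

Section UnitCircle.
Variable R : realType.
Implicit Types a b : R.

Lemma cisD a b : cis (a + b) = cis a * cis b.
Proof. by rewrite cis.unlock cosD sinD; simpc; congr (_ +i* _); rewrite addrC. Qed.

Lemma cis0 : cis (0 : R) = 1.
Proof. by rewrite cis.unlock cos0 sin0. Qed.

Lemma nc_cis a : nc (cis a) = 1.
Proof. by rewrite cis.unlock /= cos2Dsin2 sqrtr1. Qed.

Lemma cisN a : cis (- a) = ((cis a)^*)%R.
Proof. by rewrite cis.unlock cosN sinN. Qed.

Lemma cis_mulJ a : cis a * ((cis a)^*)%R = 1.
Proof. by rewrite -cisN -cisD subrr cis0. Qed.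

Lemma cis2pi (m : int) : cis (m%:~R * (pi *+ 2) : R) = 1.
Proof.
have cis2piN (k : nat) : cis (k%:R * (pi *+ 2) : R) = 1.
  elim: k => [|k IH]; first by rewrite mul0r cis0.
  by rewrite -natr1 mulrDl mul1r cisD IH mul1r cis.unlock cos2pi sin2pi.
case: m => k; first by rewrite -pmulrn cis2piN.
by rewrite NegzE rmorphN /= mulNr cisN -pmulrn cis2piN conjC1.
Qed.

Lemma cis_surj (z : R[i]) : nc z = 1 -> exists a, z = cis a.
Proof.
case: z => x y /= h.
have {}h : x ^+ 2 + y ^+ 2 = 1.
  by rewrite -[LHS]sqr_sqrtr ?h ?expr1n // addr_ge0 // sqr_ge0.
have x1 : -1 <= x <= 1.
  rewrite -ler_norml -(@ler_sqr _ `|x|) ?nnegrE // real_normK ?num_real //.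
  by rewrite expr1n -h lerDl sqr_ge0.
have sq : Num.sqrt (1 - x ^+ 2) = `|y| by rewrite -h addrC addKr sqrtr_sqr.
have [y0|/ltW y0] := leP 0 y.
  by exists (acos x); rewrite cis.unlock sin_acos // acosK ?in_itv // sq ger0_norm.
exists (- acos x); rewrite cis.unlock cosN sinN sin_acos // acosK ?in_itv // sq.
by rewrite ler0_norm // opprK.
Qed.

(** Factoring out the phase of the midpoint leaves the purely imaginary number
    [2 i sin ((a - b) / 2)]. *)
Lemma nc_cisB a b : nc (cis a - cis b) = `|sin ((a - b) / 2)| *+ 2.
Proof.
have -> : cis a - cis b = cis ((a + b) / 2) * (0 +i* (sin ((a - b) / 2) *+ 2)).
  have -> : cis a = cis ((a + b) / 2) * cis ((a - b) / 2).
    by rewrite -cisD; congr cis; lra.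
  have -> : cis b = cis ((a + b) / 2) * cis (- ((a - b) / 2)).
    by rewrite -cisD; congr cis; lra.
  rewrite -mulrBr; congr (_ * _); rewrite cis.unlock cosN sinN; simpc.
  by rewrite mulr2n.
by rewrite ncM nc_cis mul1r /= expr0n /= add0r sqrtr_sqr normrMn.
Qed.

Lemma sin_le_norm a : `|sin a| <= `|a|.
Proof.
wlog a0 : a / 0 <= a.
  move=> H; have [|/ltW a0] := leP 0 a; first exact: H.
  by have := H (- a); rewrite sinN !normrN oppr_ge0; apply.
have [c _] : exists2 c, c \in `[0, a] & sin a - sin 0 = cos c * (a - 0).
  apply: (@MVT_segment _ sin cos) => //; last exact/continuous_subspaceT/continuous_sin.
rewrite sin0 !subr0 => ->; rewrite normrM -[leRHS]mul1r.
by apply: ler_wpM2r => //; exact: cos_max.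
Qed.

Lemma cis_lip a b : nc (cis a - cis b) <= `|a - b|.
Proof.
rewrite nc_cisB; have := sin_le_norm ((a - b) / 2).
by rewrite normrM (gtr0_norm (_ : 0 < 2^-1)) ?invr_gt0 // => h; lra.
Qed.

Lemma ccts_cis (T : topologicalType) (f : T -> R) :
  continuous f -> ccts (fun t => cis (f t)).
Proof.
move=> cf; rewrite cis.unlock; apply: ccts_ReIm => x; apply: continuous_comp; try exact: cf.
  exact: continuous_cos.
exact: continuous_sin.
Qed.

Lemma sin_ge_mulcos a : 0 <= a <= pi / 2 -> a * cos a <= sin a.
Proof.
move=> /andP[a0 api].
have [c] : exists2 c, c \in `[0, a] & sin a - sin 0 = cos c * (a - 0).
  apply: (@MVT_segment _ sin cos) => //; last exact/continuous_subspaceT/continuous_sin.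
rewrite in_itv /= => /andP[c0 ca]; rewrite sin0 !subr0 => ->; rewrite mulrC.
apply: ler_wpM2r => //; have [->//|/eqP ne] := eqVneq c a.
have pi0 := pi_gt0 R.
by apply/ltW; rewrite ltr_cos ?in_itv /= ?c0 ?a0 /=;
  [rewrite lt_neqAle ca andbT; exact/eqP | lra | lra].
Qed.

(** In [sin a = 2 sin (a/2) cos (a/2)], the cosine is at least [sin (g/2)], and so is the ratio of
    [sin (a/2)] to [a/2] by [sin_ge_mulcos]; hence the square. *)
Lemma sin_lower g a : 0 < g < pi -> 0 <= a <= pi - g ->
  a * (sin (g / 2)) ^+ 2 <= sin a.
Proof.
move=> /andP[g0 gpi] /andP[a0 ag].
have pi0 := pi_gt0 R.
have k0 : 0 < sin (g / 2) by apply: sin_gt0_pi; apply/andP; split; lra.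
have e1 : sin a = (sin (a / 2) * cos (a / 2)) *+ 2.
  by rewrite {1}(_ : a = (a / 2) *+ 2) ?sin_mulr2n 1?mulrC //; lra.
have c1 : sin (g / 2) <= cos (a / 2).
  have -> : sin (g / 2) = cos (pi / 2 - g / 2).
    by rewrite cosB cos_pihalf sin_pihalf mul0r mul1r add0r.
  have [->//|ne] := eqVneq (a / 2) (pi / 2 - g / 2).
  apply/ltW; rewrite ltr_cos ?in_itv /=; try (apply/andP; split; lra).
  by rewrite lt_neqAle ne /=; lra.
have s1 : (a / 2) * cos (a / 2) <= sin (a / 2).
  by apply: sin_ge_mulcos; apply/andP; split; lra.
rewrite e1.
have : a / 2 * sin (g / 2) <= sin (a / 2).
  by apply: le_trans s1; apply: ler_wpM2l => //; lra.
move=> h; have : a / 2 * sin (g / 2) * sin (g / 2) <= sin (a / 2) * cos (a / 2).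
  apply: ler_pM => //; last by rewrite ltW.
  by apply: mulr_ge0; [lra|exact: ltW].
by move: (sin (a / 2) * cos (a / 2)) (sin (g / 2)) => x y ?; nra.
Qed.

Lemma gapC_ge0 N : 0 <= gapC R N.
Proof. by rewrite gapC.unlock invr_ge0 sqr_ge0. Qed.

Lemma cis_lower N a b : (0 < N)%N -> `|a - b| <= pi *+ 2 - gap R N *+ 2 ->
  `|a - b| <= gapC R N * nc (cis a - cis b).
Proof.
move=> N0; rewrite nc_cisB.
have pi0 := pi_gt0 R.
have g0 : 0 < gap R N by rewrite divr_gt0.
have gpi : gap R N < pi by rewrite ltr_pdivrMr // ltr_pMr // ltr1n.
have k0 : 0 < sin (gap R N / 2) by apply: sin_gt0_pi; apply/andP; split; lra.
wlog ab : a b / b <= a => [H|].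
  have [|/ltW ab h] := leP b a; first exact: H.
  have -> : (a - b) / 2 = - ((b - a) / 2) by lra.
  by rewrite sinN normrN distrC; apply: H => //; rewrite distrC.
rewrite (ger0_norm (_ : 0 <= a - b)) ?subr_ge0 // => h.
have := @sin_lower (gap R N) ((a - b) / 2); rewrite g0 gpi => /(_ isT).
have -> : 0 <= (a - b) / 2 <= pi - gap R N.
  by apply/andP; split; lra.
move=> /(_ isT) h1.
rewrite gapC.unlock mulrC ler_pdivlMr ?exprn_gt0 //.
have : sin ((a - b) / 2) <= `|sin ((a - b) / 2)| by exact: ler_norm.
move: h1; move: (sin ((a-b) /2)) (sin _ ^+2) (`|_|) => x y z ? ?; nra.
Qed.

Definition unwind a (m : int) : R := a - m%:~R * (pi *+ 2).

Lemma cis_unwind a m : cis (unwind a m) = cis a.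
Proof. by rewrite -[in RHS](subrK (m%:~R * (pi *+ 2)) a) [RHS]cisD cis2pi mulr1. Qed.

(* Among the [#|T| + 1] arcs of length [2 * gap R #|T|] covering the circle, one
   contains no [cis (a k)]; the branch of the argument is cut at its center. *)
Lemma gap_lift (T : finType) (a : T -> R) : exists m : T -> int,
  forall k l, `|unwind (a k) (m k) - unwind (a l) (m l)| <=
              gapC R #|T| * nc (cis (a k) - cis (a l)).
Proof.
have [T0|T0] := posnP #|T|.
  by exists (fun _ => 0) => k; have := fintype0 k; rewrite T0 => /(_ erefl).
have pi0 := pi_gt0 R; set N := #|T| in T0 *.
have pi2 : 0 < pi *+ 2 :> R by rewrite mulrn_wgt0.
have N1 : 0 < N.+1%:R :> R by rewrite ltr0n.
pose fl k := Num.floor (a k / (pi *+ 2)).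
pose b k := a k - (fl k)%:~R * (pi *+ 2).
have bP k : 0 <= b k < pi *+ 2.
  have := floor_itv (a k / (pi *+ 2)); rewrite -/(fl k) => /andP[].
  rewrite ler_pdivlMr // ltr_pdivrMr // intrD mulrDl mul1r /b => h1 h2.
  by apply/andP; split; lra.
pose g := gap R N.
have gN : g * N.+1%:R = pi by rewrite /g /gap divfK // gt_eqF.
have g0 : 0 < g by rewrite divr_gt0.
pose arc (j : 'I_N.+1) (k : T) := j%:R * (g *+ 2) <= b k < j.+1%:R * (g *+ 2).
(* Pigeonhole: if every arc were hit, choosing a point in each would inject [N.+1] indices into
   [T]. *)
have [j jP] : exists j : 'I_N.+1, forall k, ~~ arc j k.
  apply: contrapT => /forallNP H.
  have {}H j : exists k, arc j k.
    by apply: contrapT => /forallNP Hk; apply: (H j) => k; apply/negP/Hk.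
  have [f fP] := choice H.
  have finj : injective f.
    move=> i j ij; apply/val_inj/eqP; rewrite eqn_leq /=.
    have := fP i; have := fP j; rewrite /arc ij => /andP[h1 h2] /andP[h3 h4].
    have g2 : 0 < g *+ 2 by rewrite mulrn_wgt0.
    have := le_lt_trans h1 h4; have := le_lt_trans h3 h2.
    by rewrite !ltr_pM2r // !ltr_nat !ltnS => -> ->.
  by have := leq_card _ finj; rewrite card_ord -/N ltnn.
(* Points before the empty arc are raised by a full turn; all values then lie in one interval of
   length [2 pi - 2 * g]. *)
pose m k := if b k < j%:R * (g *+ 2) then fl k - 1 else fl k.
have key k : j.+1%:R * (g *+ 2) <= unwind (a k) (m k) <= j%:R * (g *+ 2) + pi *+ 2.
  have := jP k; have := bP k; rewrite /arc.
  have jN : j.+1%:R * (g *+ 2) <= pi *+ 2.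
    rewrite mulrnAr lerMn2r /= -gN mulrC.
    by rewrite ler_pM2l // ler_nat.
  have j0 : 0 <= j%:R * (g *+ 2) by rewrite mulr_ge0 // mulrn_wge0 // ltW.
  rewrite negb_and -!(leNgt, ltNge) /unwind /m /b => /andP[h1 h2].
  case: ifP => [h3 _|/negbT]; first by rewrite intrB mulrBl mul1r; apply/andP; split; lra.
  by rewrite -leNgt => h3 /orP[h4|h4]; apply/andP; split; lra.
exists m => k l; rewrite -(cis_unwind (a k) (m k)) -(cis_unwind (a l) (m l)).
apply: cis_lower => //; have := key k; have := key l.
rewrite -/g ler_norml -[j.+1%:R]natr1 mulrDl mul1r.
by move: (unwind (a k) _) (unwind (a l) _) (j%:R * (g *+2)) (g *+ 2) (pi *+ 2) => x y z p q
  /andP[? ?] /andP[? ?]; apply/andP; split; lra.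
Qed.

End UnitCircle.

(** * Diagonal matrices in an orthonormal basis, and Schur multipliers *)

HB.lock Definition dg (R : realType) (n : nat) (W : 'M[R[i]]_n) (x : 'I_n -> R[i]) :
  'M[R[i]]_n := W^t* *m diag_mx (\row_k x k) *m W.

Section Diag.
Variables (R : realType) (n : nat).
Implicit Types (P Q T W A B : 'M[R[i]]_n) (x y : 'I_n -> R[i]).
Let K := unK R n.

Lemma dgM W x y : W \is unitarymx -> dg W x *m dg W y = dg W (fun k => x k * y k).
Proof.
move=> uW; rewrite dg.unlock !mulmxA (mulmxtVK _ uW) -[X in X *m W]mulmxA mulmx_diag.
have -> // : \row_j ((\row_k x k) 0 j * (\row_k y k) 0 j) = \row_k (x k * y k).
by apply/rowP => k; rewrite !mxE.
Qed.

Lemma dg_cst W (c : R[i]) : W \is unitarymx -> dg W (fun=> c) = c%:M.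
Proof.
move=> uW; rewrite dg.unlock.
have -> : \row_(_ < n) c = const_mx c by apply/rowP => k; rewrite !mxE.
by rewrite diag_const_mx scalar_mxC -mulmxA unitaryVm // mulmx1.
Qed.

Lemma dg_tC W x : (dg W x)^t* = dg W (fun k => (x k)^*)%R.
Proof.
rewrite dg.unlock !tC_mul trmxCK mulmxA tr_diag_mx map_diag_mx.
have -> // : map_mx Num.conj (\row_k x k) = \row_k (x k)^*%R.
by apply/rowP => k; rewrite !mxE.
Qed.

Lemma dgB W x y : dg W x - dg W y = dg W (fun k => x k - y k).
Proof.
rewrite dg.unlock -mulmxBl -mulmxBr.
have -> // : diag_mx (\row_k x k) - diag_mx (\row_k y k) = diag_mx (\row_k (x k - y k)).
by apply/matrixP => i j; rewrite !mxE mulrnBl.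
Qed.

Lemma dg_unitary W x :
  W \is unitarymx -> (forall k, x k * (x k)^*%R = 1) -> dg W x \is unitarymx.
Proof.
move=> uW xJ; apply/unitarymxP; rewrite dg_tC dgM // -(dg_cst 1 uW).
by congr dg; apply/funext.
Qed.

Lemma dg_cis_unitary W (a : 'I_n -> R) :
  W \is unitarymx -> dg W (fun k => cis (a k)) \is unitarymx.
Proof. by move=> uW; apply: dg_unitary => // k; exact: cis_mulJ. Qed.

Lemma row_dg W x k : W \is unitarymx -> row k W *m dg W x = x k *: row k W.
Proof.
move=> uW; rewrite dg.unlock !mulmxA -row_mul (unitarymxP uW).
by rewrite row1 -rowE row_diag_mx mxE -scalemxAl -rowE.
Qed.

Lemma dg_col W x k : W \is unitarymx -> dg W x *m (row k W)^t* = x k *: (row k W)^t*.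
Proof.
move=> uW; have := row_dg (fun k => (x k)^*)%R k uW; rewrite -dg_tC.
move=> /(congr1 (fun M => M^t*)); rewrite tC_mul trmxCK => ->.
by apply/matrixP => i j; rewrite !mxE rmorphM /= conjCK.
Qed.

Lemma dg_sum W x : dg W x = \sum_k x k *: ((row k W)^t* *m row k W).
Proof.
rewrite dg.unlock; apply/matrixP => i j; rewrite mxE summxE; apply: eq_bigr => k _.
rewrite mul_mx_diag !mxE big_ord_recl big_ord0 addr0 !mxE.
by rewrite mulrA [x k * _]mulrC.
Qed.

Lemma nrm_dg W x c : W \is unitarymx -> 0 <= c -> (forall k, nc (x k) <= c) ->
  nrm (dg W x) <= K ^+ 3 * c.
Proof.
move=> uW c0 xc; rewrite dg.unlock; apply: le_trans (nrm_mulUr _ uW) _.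
rewrite exprS -mulrA; apply: ler_wpM2l; first exact: unK_ge0.
apply: le_trans (nrm_mulUl _ _) _; first by rewrite trmxC_unitary.
rewrite expr2 -mulrA; apply: ler_wpM2l; first exact: unK_ge0.
apply: nrm_le_unK => // i j; rewrite !mxE; case: eqVneq => _; rewrite ?mulr1n //.
by rewrite mulr0n nc0.
Qed.

(** This turns commutators, and with [T = 1] differences, into entrywise products, so that bounds
    for spectral functions reduce to inequalities between numbers. *)
Lemma dg_entry P Q T x y i j : P \is unitarymx -> Q \is unitarymx ->
  (P *m (dg P x *m T - T *m dg Q y) *m Q^t*) i j
  = (x i - y j) * (P *m T *m Q^t*) i j.
Proof.
move=> uP uQ; rewrite mulmxBr mulmxBl dg.unlock !mulmxA (unitarymxP uP) mul1mx.
rewrite (mulmxtVK _ uQ) -!(mulmxA (diag_mx _)) [diag_mx _ *m (_ *m _)]mulmxA.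
rewrite -[diag_mx _ *m _ *m _]mulmxA; move: (P *m T *m Q^t*) => Z.
by rewrite mul_diag_mx mul_mx_diag !mxE mulrBl [_ * y j]mulrC.
Qed.

(** Entrywise domination of the multipliers dominates [nrm]; the four multiplications by unitaries,
    two into the bases and two back, cost [K ^+ 4]. *)
Lemma nrm_le_Schur P Q Z Z' M (z z' : 'I_n -> 'I_n -> R[i]) C :
  P \is unitarymx -> Q \is unitarymx -> 0 <= C ->
  (forall i j, (P *m Z' *m Q^t*) i j = z' i j * M i j) ->
  (forall i j, (P *m Z *m Q^t*) i j = z i j * M i j) ->
  (forall i j, nc (z' i j) <= C * nc (z i j)) ->
  nrm Z' <= C * K ^+ 4 * nrm Z.
Proof.
move=> uP uQ C0 hZ' hZ h.
have uP' := unitary_tC uP.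
have uQ' := unitary_tC uQ.
have e : Z' = P^t* *m (P *m Z' *m Q^t*) *m Q.
  by rewrite !mulmxA unitaryVm // mul1mx -mulmxA unitaryVm // mulmx1.
have hC : nrm (P *m Z' *m Q^t*) <= C * nrm (P *m Z *m Q^t*).
  rewrite nrm.unlock mulr_sumr; apply: ler_sum => i _; rewrite mulr_sumr.
  apply: ler_sum => j _; rewrite hZ hZ' !ncM mulrA.
  by apply: ler_wpM2r; [exact: nc_ge0 | exact: h].
have h1 := nrm_mulUr (P^t* *m (P *m Z' *m Q^t*)) uQ; rewrite -e in h1.
have h2 := nrm_mulUl (P *m Z' *m Q^t*) uP'.
have h3 := nrm_mulUr (P *m Z) uQ'.
have h4 := nrm_mulUl Z uP.
have K0 : 0 <= K by exact: unK_ge0.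
apply: (le_trans h1); rewrite -/K in h2 h3 h4 *.
have -> : C * K ^+ 4 * nrm Z = K * (K * (C * (K * (K * nrm Z)))) by ring.
apply: (ler_wpM2l K0); apply: (le_trans h2); apply: (ler_wpM2l K0).
apply: (le_trans hC); apply: (ler_wpM2l C0); apply: (le_trans h3).
exact: (ler_wpM2l K0).
Qed.

(* Spectral functions are Lipschitz with respect to the norm because, in the
   bases [P] and [Q], both sides are Schur multiples of [P *m T *m Q^t*]. *)
Lemma transfer P Q T x y x' y' C : P \is unitarymx -> Q \is unitarymx -> 0 <= C ->
  (forall i j, nc (x' i - y' j) <= C * nc (x i - y j)) ->
  nrm (dg P x' *m T - T *m dg Q y') <= C * K ^+ 4 * nrm (dg P x *m T - T *m dg Q y).
Proof.
move=> uP uQ C0 h.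
exact: (nrm_le_Schur uP uQ C0 (fun i j => dg_entry T x' y' i j uP uQ)
  (fun i j => dg_entry T x y i j uP uQ) h).
Qed.

Lemma transfer1 P Q x y x' y' C : P \is unitarymx -> Q \is unitarymx -> 0 <= C ->
  (forall i j, nc (x' i - y' j) <= C * nc (x i - y j)) ->
  nrm (dg P x' - dg Q y') <= C * K ^+ 4 * nrm (dg P x - dg Q y).
Proof.
by move=> uP uQ C0 h; have := @transfer P Q 1%:M x y x' y' C uP uQ C0 h;
  rewrite !mulmx1 !mul1mx.
Qed.

End Diag.

(** * Simultaneous unitary diagonalization *)

Section Codiagonalization.
Variables (R : realType) (n : nat).
Implicit Types (A B P : 'M[R[i]]_n) (S : set 'M[R[i]]_n).

(** Reduces the infinite family of all values of [phi] at a point to a list: each matrix outside the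
    current span raises the dimension, which is bounded. *)
Lemma finite_spanning S : exists s : seq 'M[R[i]]_n,
  (forall A, A \in s -> S A) /\ (forall A, S A -> A \in span s).
Proof.
have key k : exists s : seq 'M[R[i]]_n, (forall A, A \in s -> S A) /\
    ((forall A, S A -> A \in span s) \/ (k <= \dim (span s))%N).
  elim: k => [|k [s [sS [h|h]]]]; first by exists [::]; split => //; right.
    by exists s; split => //; left.
  have [H|/existsNP [A /not_implyP [SA /negP As]]] := pselect (forall A, S A -> A \in span s).
    by exists s; split => //; left.
  exists (A :: s); split; first by move=> B; rewrite inE => /orP[/eqP->//|/sS].
  right; rewrite span_cons; apply: leq_ltn_trans h _.
  rewrite ltn_neqAle dimvS ?addvSr // andbT; apply/negP => /eqP e.
  have : (span s == <[A]> + span s)%VS by rewrite eqEdim addvSr e leqnn.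
  move=> /eqP e'; case/negP: As; rewrite e'.
  exact: subvP (addvSl _ _) _ (memv_line A).
have [s [sS [h|h]]] := key (\dim (fullv : {vspace 'M[R[i]]_n})).+1.
  by exists s.
by have := leq_trans h (dimvS (subvf (span s))); rewrite ltnn.
Qed.

(** A spanning list together with its adjoints is brought to triangular form by one unitary; a
    matrix that is triangular along with its adjoint is diagonal. *)
Lemma codiagonalization S :
  (forall A B, S A -> S B -> A *m B = B *m A) ->
  (forall A B, S A -> S B -> A *m B^t* = B^t* *m A) ->
  exists2 P, P \is unitarymx & forall A, S A -> exists x, A = dg P x.
Proof.
move=> cS cS'; have [s [sS spS]] := finite_spanning S.
have [|P uP /allP Ptrig] := @cotrigonalization _ n (s ++ [seq (A^t*) | A <- s]).
  move=> A B; rewrite !mem_cat => /orP[/sS SA|/mapP[A' /sS SA ->]]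
    /orP[/sS SB|/mapP[B' /sS SB ->]]; rewrite /comm_mx.
  - exact: cS.
  - exact: cS'.
  - by symmetry; exact: cS'.
  - by rewrite -!tC_mul cS.
exists P => // A SA; have Aspan := @coord_span _ _ _ (in_tuple s) A (spS A SA).
have diag_s B : B \in s -> forall i j, i != j -> (P *m B *m P^t*) i j = 0.
  move=> Bs; have trigP (M : 'M[R[i]]_n) : M \in s ++ [seq (A^t*) | A <- s] ->
      forall i j : 'I_n, (i < j)%N -> (P *m M *m P^t*) i j = 0.
    by move=> /Ptrig /is_trig_mxP h i j ij; have := h i j ij; rewrite conjymx.
  move=> i j; case: (ltngtP i j) => [ij _|ji _|/val_inj -> /eqP //].
    by apply: trigP => //; rewrite mem_cat Bs.
  have Bs' : B^t* \in s ++ [seq (A^t*) | A <- s].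
    by rewrite mem_cat; apply/orP; right; apply/mapP; exists B.
  have := trigP _ Bs' j i ji.
  have -> : P *m B^t* *m P^t* = (P *m B *m P^t*)^t* by rewrite !tC_mul trmxCK mulmxA.
  by rewrite !mxE => /eqP; rewrite conjC_eq0 => /eqP.
have e : P *m A *m P^t* = diag_mx (\row_k (P *m A *m P^t*) k k).
  apply/matrixP => i j; have [<-|ij] := eqVneq i j; first by rewrite [RHS]mxE eqxx mulr1n [RHS]mxE.
  rewrite [RHS]mxE (negbTE ij) mulr0n Aspan mulmx_sumr mulmx_suml summxE big1 // => k _.
  by rewrite -scalemxAr -scalemxAl mxE diag_s ?mulr0 // mem_nth.
exists (fun k => (P *m A *m P^t*) k k); rewrite dg.unlock -e.
by rewrite !mulmxA unitaryVm // mul1mx -mulmxA unitaryVm // mulmx1.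
Qed.

End Codiagonalization.

(** * Commutator estimates *)

Section Commutator.
Variables (R : realType) (n : nat).
Implicit Types (A X Y : 'M[R[i]]_n).
Let K := unK R n.

Definition cm X A : R := nrm (X *m A - A *m X).

Lemma cmM X Y A : X \is unitarymx -> Y \is unitarymx ->
  cm (X *m Y) A <= K * (cm X A + cm Y A).
Proof.
move=> uX uY; rewrite /cm.
have -> : X *m Y *m A - A *m (X *m Y) =
    (X *m A - A *m X) *m Y + X *m (Y *m A - A *m Y).
  by rewrite mulmxBl mulmxBr !mulmxA [RHS]addrC addrA subrK.
apply: le_trans (nrmD _ _) _; rewrite mulrDr; apply: lerD.
  exact: nrm_mulUr.
exact: nrm_mulUl.
Qed.

Lemma cm_tC X A : X \is unitarymx -> cm (X^t*) A <= K ^+ 2 * cm X A.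
Proof.
move=> uX; rewrite /cm.
have -> : X^t* *m A - A *m X^t* = - (X^t* *m (X *m A - A *m X) *m X^t*).
  rewrite mulmxBr mulmxBl !mulmxA unitaryVm // mul1mx -[_ *m X *m X^t*]mulmxA.
  by rewrite (unitarymxP uX) mulmx1 opprB.
have uX' : X^t* \is unitarymx by rewrite trmxC_unitary.
rewrite nrmN expr2 -mulrA; apply: le_trans (nrm_mulUr _ uX') _.
by apply: ler_wpM2l; [exact: unK_ge0 | exact: nrm_mulUl].
Qed.

Lemma cm_near X Y A : cm X A <= cm X Y + 2 * nrm X * nrm (A - Y).
Proof.
rewrite /cm.
have -> : X *m A - A *m X = (X *m Y - Y *m X) + (X *m (A - Y) - (A - Y) *m X).
  rewrite mulmxBr mulmxBl [- (A *m X - _)]opprD [X in _ = _ + X]addrACA -opprD.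
  by rewrite [RHS]addrC subrK.
apply: le_trans (nrmD _ _) _; rewrite lerD2l; apply: le_trans (nrmB _ _) _.
have := nrmM X (A - Y); have := nrmM (A - Y) X.
by move: (nrm X) (nrm (A - Y)) => a b h1 h2; lra.
Qed.

End Commutator.

(** * Contraction of unitaries close to 1 *)

HB.lock Definition cayden (R : realType) (n : nat) (r : R) (v : 'M[R[i]]_n) :
  'M[R[i]]_n := (1 - r)%:C *: v + (1 + r)%:C%:M.

(* The Moebius contraction of the circle onto [1] that fixes [1] and is
   multiplication by [r] after the Cayley transform. *)
HB.lock Definition cay (R : realType) (n : nat) (r : R) (v : 'M[R[i]]_n) :
  'M[R[i]]_n := ((1 + r)%:C *: v + (1 - r)%:C%:M) *m invmx (cayden r v).

Section Cayley.
Variables (R : realType) (n : nat).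
Implicit Types (A v : 'M[R[i]]_n) (r : R).
Let K := unK R n.

Lemma caydenE r v : cayden r v = 2%:R%:M + (1 - r)%:C *: (v - 1%:M).
Proof.
rewrite cayden.unlock scalerBr scale_scalar_mx mulr1 addrCA -raddfB /=; congr (_ + _%:M).
by rewrite -[2%:R](rmorph_nat (@real_complex R)) -rmorphB /=; congr (_%:C); ring.
Qed.

(** By [caydenE] the matrix is 2 plus a perturbation of norm at most 1/2; a matrix [k] killed by it
    would satisfy [2 * nrm k <= nrm k / 2]. *)
Lemma cayden_unit r v : 0 <= r <= 1 -> nrm (v - 1%:M) <= 2^-1 -> cayden r v \in unitmx.
Proof.
move=> /andP[r0 r1] hv; rewrite -row_free_unit -kermx_eq0; apply/eqP/nrm_eq0.
set k := kermx _; have : k *m cayden r v = 0 by exact: mulmx_ker.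
rewrite caydenE mulmxDr mul_mx_scalar -scalemxAr => /eqP; rewrite addr_eq0 => /eqP e.
have : nrm (2%:R *: k) <= 2^-1 * nrm k.
  rewrite e nrmN nrmZ nc_real ger0_norm ?subr_ge0 //.
  apply: (@le_trans _ _ (1 * nrm (k *m (v - 1%:M)))).
    by apply: ler_wpM2r; [exact: nrm_ge0 | lra].
  rewrite mul1r; apply: le_trans (nrmM _ _) _; rewrite mulrC.
  by apply: ler_wpM2r => //; exact: nrm_ge0.
rewrite nrmZ -[2%:R](rmorph_nat (@real_complex R)) nc_real ger0_norm //.
by have := nrm_ge0 k; lra.
Qed.

(** The equation [2 q = 1 - (1 - r) q (v - 1)] for the inverse [q] lets its norm on the right be
    absorbed on the left. *)
Lemma nrm_invcayden r v : 0 <= r <= 1 -> nrm (v - 1%:M) <= 2^-1 ->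
  nrm (invmx (cayden r v)) <= K.
Proof.
move=> r01 hv; have uq := cayden_unit r01 hv; have /andP[r0 r1] := r01.
set q := invmx _.
have e : 2%:R *: q = 1%:M - (1 - r)%:C *: (q *m (v - 1%:M)).
  have := mulVmx uq; rewrite -/q [X in q *m X]caydenE mulmxDr mul_mx_scalar -scalemxAr.
  by move=> h; apply/eqP; rewrite eq_sym subr_eq; apply/eqP; exact: esym h.
have : nrm (2%:R *: q) <= K + 2^-1 * nrm q.
  rewrite e; apply: le_trans (nrmB _ _) _; apply: lerD; first exact: nrm1.
  rewrite nrmZ nc_real ger0_norm ?subr_ge0 //.
  apply: (@le_trans _ _ (1 * nrm (q *m (v - 1%:M)))).
    by apply: ler_wpM2r; [exact: nrm_ge0 | lra].
  rewrite mul1r; apply: le_trans (nrmM _ _) _; rewrite mulrC.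
  by apply: ler_wpM2r => //; exact: nrm_ge0.
rewrite nrmZ -[2%:R](rmorph_nat (@real_complex R)) nc_real ger0_norm //.
by have := nrm_ge0 q; have := unK_ge0 R n; rewrite -/K; lra.
Qed.

(** The form used for estimates: the deviation from 1 carries the factors [r] and [v - 1]. *)
Lemma cayE r v : 0 <= r <= 1 -> nrm (v - 1%:M) <= 2^-1 ->
  cay r v = 1%:M + (2%:R * r)%:C *: ((v - 1%:M) *m invmx (cayden r v)).
Proof.
move=> r01 hv; have uq := cayden_unit r01 hv.
rewrite cay.unlock -[X in _ = X + _](mulmxV uq) scalemxAl -mulmxDl; congr (_ *m _).
rewrite cayden.unlock; have -> : (1 + r)%:C = 1 + r%:C by rewrite rmorphD /= rmorph1.
have -> : (1 - r)%:C = 1 - r%:C by rewrite rmorphB /= rmorph1.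
have -> : (2%:R * r)%:C = 2%:R * r%:C by rewrite rmorphM /= rmorph_nat.
apply/matrixP => i j; rewrite !mxE.
by move: (v i j) (_%:C) => z c; case: (i == j); rewrite ?mulr1n ?mulr0n; ring.
Qed.

Lemma cay1 v : nrm (v - 1%:M) <= 2^-1 -> cay 1 v = v.
Proof.
move=> hv; have uq : cayden 1 v \in unitmx by apply: cayden_unit; rewrite // ler01 lexx.
apply: (can_inj (mulmxK uq)); rewrite cay.unlock mulmxKV // cayden.unlock subrr scale0r raddf0 addr0 add0r.
by rewrite mul_mx_scalar.
Qed.

Lemma cay0 v : nrm (v - 1%:M) <= 2^-1 -> cay 0 v = 1%:M.
Proof. by move=> hv; rewrite cayE ?lexx ?ler01 // mulr0 scale0r addr0. Qed.

Lemma nrm_11 : nrm (1%:M - 1%:M : 'M[R[i]]_n) <= 2^-1.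
Proof. by rewrite subrr nrm0 invr_ge0. Qed.

Lemma cay_id r : 0 <= r <= 1 -> cay r 1%:M = 1%:M :> 'M[R[i]]_n.
Proof. by move=> r01; rewrite cayE ?nrm_11 // subrr mul0mx scaler0 addr0. Qed.

Lemma tC_affine (a b : R) v :
  (a%:C *: v + b%:C%:M)^t* = a%:C *: v^t* + b%:C%:M.
Proof.
have cr (x : R) : ((x%:C)^*)%R = x%:C by rewrite conj_Creal // complex_real.
by apply/matrixP => i j; rewrite !mxE rmorphD rmorphM rmorphMn /= !cr eq_sym.
Qed.

Lemma affine_sqr (a b : R[i]) v : v \is unitarymx ->
  (a *: v^t* + b%:M) *m (a *: v + b%:M) =
  (a * a + b * b)%:M + (a * b) *: (v^t* + v).
Proof.
move=> uv; rewrite mulmxDl mul_scalar_mx mulmxDr mul_mx_scalar.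
have -> : a *: v^t* *m (a *: v) = (a * a)%:M.
  by rewrite -scalemxAl -scalemxAr unitaryVm // scalerA scale_scalar_mx mulr1.
rewrite scalerDr scale_scalar_mx scalerA scalerA [b * a]mulrC raddfD /= scalerDr.
by rewrite -!addrA; congr (_ + _); rewrite addrA [RHS]addrC.
Qed.

(** Numerator and denominator have the same square [p^t* p]: by [affine_sqr] it is symmetric in the
    two coefficients [1 + r] and [1 - r]. *)
Lemma cay_unitary r v : 0 <= r <= 1 -> nrm (v - 1%:M) <= 2^-1 ->
  v \is unitarymx -> cay r v \is unitarymx.
Proof.
move=> r01 hv uv; have uq := cayden_unit r01 hv.
rewrite -trmxC_unitary; apply/unitarymxP; rewrite trmxCK cay.unlock tC_mul mulmxA.
set p := _ + _; set q := cayden r v.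
have pq : p^t* *m p = q^t* *m q.
  rewrite /p /q cayden.unlock (tC_affine (1 + r)) (tC_affine (1 - r)).
  rewrite (affine_sqr (1 + r)%:C _ uv) (affine_sqr (1 - r)%:C _ uv).
  by rewrite [X in X%:M + _]addrC [X in _ + X *: _]mulrC.
rewrite -(mulmxA _ (p^t*) p) pq mulmxA -tC_mul mulmxV //.
by rewrite trmx1 map_mx1 mul1mx mulmxV.
Qed.

Lemma cay_near r v : 0 <= r <= 1 -> nrm (v - 1%:M) <= 2^-1 ->
  nrm (cay r v - 1%:M) <= 2 * K * nrm (v - 1%:M).
Proof.
move=> r01 hv; have /andP[r0 r1] := r01.
rewrite cayE // addrC addKr nrmZ nc_real ger0_norm ?mulr_ge0 // -mulrA.
apply: ler_pM; rewrite ?mulr_ge0 ?nrm_ge0 //; first lra.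
apply: le_trans (nrmM _ _) _; rewrite mulrC; apply: ler_wpM2r; first exact: nrm_ge0.
exact: nrm_invcayden.
Qed.

(** Twice the sum of [K], for one inverse, and [K ^+ 2 / 2], for two inverses and the factor
    [v - 1]. *)
Definition cayC : R := 2 * K + K ^+ 2.

(** Leibniz rule on [cayE]. The commutator with the inverse is minus that with the denominator
    between two inverses, and the latter is a multiple of [v A - A v]. *)
Lemma cm_cay r v A : 0 <= r <= 1 -> nrm (v - 1%:M) <= 2^-1 ->
  cm (cay r v) A <= cayC * cm v A.
Proof.
move=> r01 hv; have /andP[r0 r1] := r01; have uq := cayden_unit r01 hv.
have nq := nrm_invcayden r01 hv.
set q := cayden r v in uq nq; set D := v *m A - A *m v.
have Dq : q *m A - A *m q = (1 - r)%:C *: D.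
  rewrite /q cayden.unlock mulmxDl mulmxDr -scalemxAl -scalemxAr mul_scalar_mx mul_mx_scalar.
  by rewrite opprD addrACA subrr addr0 -scalerBr.
have Dq' : invmx q *m A - A *m invmx q = - (invmx q *m (q *m A - A *m q) *m invmx q).
  by rewrite mulmxBr mulmxBl !mulmxA mulVmx // mul1mx -[_ *m q *m _]mulmxA mulmxV // mulmx1 opprB.
have e : cay r v *m A - A *m cay r v = (2%:R * r)%:C *: (D *m invmx q -
    (1 - r)%:C *: ((v - 1%:M) *m (invmx q *m D *m invmx q))).
  rewrite cayE // -/q mulmxDl mulmxDr mul1mx mulmx1 opprD addrACA subrr add0r.
  rewrite -scalemxAl -scalemxAr -scalerBr; congr (_ *: _).
  have -> : (v - 1%:M) *m invmx q *m A - A *m ((v - 1%:M) *m invmx q) =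
     D *m invmx q + (v - 1%:M) *m (invmx q *m A - A *m invmx q).
    have -> : D = (v - 1%:M) *m A - A *m (v - 1%:M).
      by rewrite mulmxBl mulmxBr mul1mx mulmx1 opprB addrA subrK.
    move: (v - 1%:M) (invmx q) => E q'.
    by rewrite mulmxBl mulmxBr !mulmxA [RHS]addrC addrA subrK.
  by rewrite Dq' Dq mulmxN -!scalemxAr -!scalemxAl -!scalemxAr.
have D0 : 0 <= nrm D by exact: nrm_ge0.
have q0 : 0 <= nrm (invmx q) by exact: nrm_ge0.
have K0 : 0 <= K by exact: unK_ge0.
have n1 := nrmM D (invmx q).
have n2 := nrmM (v - 1%:M) (invmx q *m D *m invmx q).
have n3 := nrmM (invmx q *m D) (invmx q).
have n4 := nrmM (invmx q) D.
rewrite /cm e nrmZ nc_real ger0_norm ?mulr_ge0 // -/D.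
have n5 : nrm (D *m invmx q) <= K * nrm D.
  by apply: le_trans n1 _; rewrite mulrC; apply: ler_wpM2r.
have n6 : nrm (invmx q *m D *m invmx q) <= K ^+ 2 * nrm D.
  apply: le_trans n3 _; rewrite expr2 -mulrA mulrC; apply: ler_pM => //; first exact: nrm_ge0.
  by apply: le_trans n4 _; apply: ler_wpM2r.
have n7 : nrm ((v - 1%:M) *m (invmx q *m D *m invmx q)) <= 2^-1 * (K ^+ 2 * nrm D).
  by apply: le_trans n2 _; apply: ler_pM => //; exact: nrm_ge0.
have n8 : nrm ((1 - r)%:C *: ((v - 1%:M) *m (invmx q *m D *m invmx q)))
    <= 2^-1 * (K ^+ 2 * nrm D).
  rewrite nrmZ nc_real ger0_norm ?subr_ge0 //; apply: le_trans n7.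
  by rewrite ler_piMl ?nrm_ge0 // lerBlDr lerDl.
have n9 := nrmB (D *m invmx q) ((1 - r)%:C *: ((v - 1%:M) *m (invmx q *m D *m invmx q))).
set Z := nrm (_ - _) in n9 *; have Z0 : 0 <= Z by exact: nrm_ge0.
clear - r0 r1 n5 n8 n9 Z0; apply: (@le_trans _ _ (2 * Z)).
  by apply: (ler_wpM2r Z0); lra.
by rewrite /cayC mulrDl; lra.
Qed.

Lemma mcts_cay (T : topologicalType) (f : T -> R) (g : T -> 'M[R[i]]_n) :
  (forall t, 0 <= f t <= 1) -> (forall t, nrm (g t - 1%:M) <= 2^-1) ->
  continuous f -> mcts g -> mcts (fun t => cay (f t) (g t)).
Proof.
move=> f01 hg cf cg.
have cC (h : T -> R) : continuous h -> ccts (fun t => (h t)%:C).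
  by move=> ch; apply: ccts_ReIm => // x; exact: cvg_cst.
have cP : continuous (fun t => 1 + f t) by move=> x; apply: cvgD; [exact: cvg_cst | exact: cf].
have cM : continuous (fun t => 1 - f t) by move=> x; apply: cvgB; [exact: cvg_cst | exact: cf].
have cS (h : T -> R) : continuous h -> mcts (fun t => (h t)%:C%:M : 'M[R[i]]_n).
  move=> ch; have -> : (fun t => (h t)%:C%:M) = (fun t => (h t)%:C *: (1%:M : 'M[R[i]]_n)).
    by apply/funext => t; rewrite scale_scalar_mx mulr1.
  by apply: mctsZ; [exact: cC | exact: mcts_cst].
rewrite cay.unlock; apply: mctsM; first by apply: mctsD; [apply: mctsZ => //; exact: cC | exact: cS].
apply: (@mcts_inv _ _ _ _ K) => [t|t|].
- exact: cayden_unit.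
- exact: nrm_invcayden.
- by rewrite cayden.unlock; apply: mctsD; [apply: mctsZ => //; exact: cC | exact: cS].
Qed.

End Cayley.

(** * Functional calculus in an eigenbasis *)

Section SpectralFunctions.
Variables (R : realType) (n : nat).
Implicit Types (P Q W u A : 'M[R[i]]_n) (x y : 'I_n -> R[i]).

Lemma dg_inj W x y : W \is unitarymx -> dg W x = dg W y -> x = y.
Proof.
move=> uW e; apply/funext => k.
have := row_dg x k uW; rewrite e row_dg // => /(congr1 (fun M => M *m (row k W)^t*)).
have one : row k W *m (row k W)^t* = 1%:M.
  apply/matrixP => i j; rewrite !ord1.
  have /matrixP /(_ k k) := unitarymxP uW; rewrite !mxE !eqxx => <-.
  by apply: eq_bigr => l _; rewrite !mxE.
by rewrite -!scalemxAl one => /matrixP /(_ 0 0); rewrite !mxE eqxx !mulr1.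
Qed.

Lemma dg_unimodular W x k :
  W \is unitarymx -> dg W x \is unitarymx -> nc (x k) = 1.
Proof.
move=> uW /unitarymxP; rewrite dg_tC dgM // -(dg_cst 1 uW) => /(dg_inj uW).
move=> /(congr1 (fun f => f k)) /=; rewrite -nc_sqr => /complexI/eqP.
by rewrite sqrp_eq1 ?nc_ge0 // => /eqP.
Qed.

Lemma unitary_cis W u x : W \is unitarymx -> u \is unitarymx -> u = dg W x ->
  exists a : 'I_n -> R, u = dg W (fun k => cis (a k)).
Proof.
move=> uW uu e; rewrite e in uu.
have /choice [a aP] : forall k, exists a, x k = cis a.
  by move=> k; apply: cis_surj; exact: dg_unimodular uu.
by exists a; rewrite e; congr dg; apply/funext.
Qed.

Lemma dg_fun P Q x y (g : R[i] -> R[i]) : P \is unitarymx -> Q \is unitarymx ->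
  dg P x = dg Q y -> dg P (g \o x) = dg Q (g \o y).
Proof.
move=> uP uQ e; apply/eqP; rewrite -subr_eq0; apply/eqP/nrm_eq0.
(* On finitely many eigenvalues any [g] is Lipschitz; the sum of all difference quotients is a
   constant. Where the eigenvalues agree, the quotient is 0 by convention and both sides of the
   estimate vanish. *)
pose c i j := nc (g (x i) - g (y j)) / nc (x i - y j).
have c0 i j : 0 <= c i j by rewrite divr_ge0 ?nc_ge0.
have C0 : 0 <= \sum_i \sum_j c i j by apply: sumr_ge0 => i _; apply: sumr_ge0 => j _.
apply: le_trans (transfer1 (x := x) (y := y) uP uQ C0 _) _; last first.
  by rewrite e subrr nrm0 mulr0.
move=> i j /=; have [->|xy] := eqVneq (x i) (y j).
  by rewrite !subrr nc0 mulr0.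
have xy0 : 0 < nc (x i - y j) by rewrite lt_neqAle nc_ge0 eq_sym nc_eq0 subr_eq0 xy.
rewrite -ler_pdivrMr // -/(c i j) (bigD1 i) //= (bigD1 j) //= -addrA lerDl.
apply: addr_ge0; first by apply: sumr_ge0.
by apply: sumr_ge0 => ? _; apply: sumr_ge0.
Qed.

End SpectralFunctions.

(** * Joint approximate diagonalization at one point *)

Section ApproximateDiagonalization.
Variables (R : realType) (n : nat).
Implicit Types (A E W u h : 'M[R[i]]_n) (x y : 'I_n -> R[i]) (S F : set 'M[R[i]]_n).
Let K := unK R n.

(** Since [S] is closed under adjoints, [u] commutes with the adjoints of [S] as well, so it can be
    added to the family. *)
Lemma exact_codiag S u : u \is unitarymx ->
  (forall A B, S A -> S B -> A *m B = B *m A) -> (forall A, S A -> S (A^t*)) ->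
  (forall A, S A -> u *m A = A *m u) ->
  exists W (a : 'I_n -> R), [/\ W \is unitarymx, u = dg W (fun k => cis (a k)) &
    forall A, S A -> exists x, A = dg W x].
Proof.
move=> uu cS sS uS.
have uS' A : S A -> u *m A^t* = A^t* *m u by move=> /sS; exact: uS.
have uS2 A : S A -> A *m u^t* = u^t* *m A.
  by move=> /uS' /(congr1 (fun M => M^t*)); rewrite !tC_mul trmxCK.
have [|A B SA SB|W uW WS] := @codiagonalization _ _ (S `|` [set u]).
- move=> A B [SA|->] [SB|->] //; [exact: cS| by rewrite uS | exact: uS].
- case: SA SB => [SA|->] [SB|->]; [exact: cS (sS _ SB) | exact: uS2 | exact: uS' |].
  by rewrite (unitarymxP uu) unitaryVm.
have [x ux] := WS u (or_intror erefl).
have [a ua] := unitary_cis uW uu ux.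
by exists W, a; split => // A SA; apply: WS; left.
Qed.

Lemma path_dist (e : rel 'I_n) x (eta : R) k p : 
  (forall i j, e i j -> nc (x i - x j) <= eta) -> path e k p ->
  nc (x k - x (last k p)) <= (size p)%:R * eta.
Proof.
move=> h; elim: p k => [|l p IH] k /=; first by rewrite subrr nc0 mul0r.
move=> /andP[ekl /IH hp]; rewrite -natr1 mulrDl mul1r [leRHS]addrC.
have -> : x k - x (last l p) = (x k - x l) + (x l - x (last l p)) by rewrite addrA subrK.
by apply: le_trans (ncD _ _) _; apply: lerD => //; exact: h.
Qed.

(** A path without repetition visits at most [n] indices, so a cluster has diameter at most
    [n * eta]. *)
Lemma connect_dist (e : rel 'I_n) x (eta : R) k l : 0 <= eta ->
  (forall i j, e i j -> nc (x i - x j) <= eta) -> connect e k l ->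
  nc (x k - x l) <= n%:R * eta.
Proof.
move=> e0 h /connectP [p ep ->]; case/shortenP: ep => p' ep' up' _.
apply: le_trans (path_dist h ep') _; apply: ler_wpM2r => //; rewrite ler_nat.
have := max_card (mem (k :: p')); rewrite card_ord (card_uniqP up') /=.
exact: ltnW.
Qed.

(* The basis [W] diagonalizes the part of [h] that is block diagonal, in the
   basis [E], for the clusters of [e]. *)
Lemma block_part (e : rel 'I_n) E h (eta : R) : E \is unitarymx -> h^t* = h ->
  (forall i j, e i j = e j i) -> 0 <= eta ->
  (forall i j, ~~ e i j -> nc ((E *m h *m E^t*) i j) <= eta) ->
  exists W (a : 'I_n -> R), [/\ W \is unitarymx,
    nrm (h - dg W (fun k => (a k)%:C)) <= K ^+ 3 * eta &
    forall x, exists y, dg E (x \o fingraph.root e) = dg W y].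
Proof.
move=> uE hh esym eta0 hoff.
have csym : connect_sym e by apply: sym_connect_sym.
set H := E *m h *m E^t* in hoff.
have HH : H^t* = H by rewrite /H !tC_mul trmxCK hh mulmxA.
pose H' : 'M[R[i]]_n := \matrix_(i, j) if connect e i j then H i j else 0.
have HH' : H'^t* = H'.
  have HHij i j : ((H j i)^*)%R = H i j by rewrite -[in RHS]HH [RHS]mxE [H^T _ _]mxE.
  apply/matrixP => i j; rewrite [LHS]mxE [H'^T _ _]mxE [H' j i]mxE [RHS]mxE csym.
  by case: ifP => _; [exact: HHij | exact: conjC0].
(* Numbering the clusters gives them distinct eigenvalues: [dg E c] commutes with the block diagonal
   [h'], and whatever is constant on clusters is a function of it. *)
pose c (k : 'I_n) : R[i] := (fingraph.root e k : nat)%:R.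
pose h' := E^t* *m H' *m E.
have hh' : h'^t* = h' by rewrite /h' !tC_mul trmxCK HH' mulmxA.
have cc' : (dg E c)^t* = dg E c.
  by rewrite dg_tC; congr dg; apply/funext => k; rewrite /c conjC_nat.
have cm' : h' *m dg E c = dg E c *m h'.
  rewrite dg.unlock /h' (conj_unitaryM _ _ uE) (conj_unitaryM _ _ uE).
  have -> // : H' *m diag_mx (\row_k c k) = diag_mx (\row_k c k) *m H'.
  apply/matrixP => i j; rewrite mul_diag_mx mul_mx_diag [LHS]mxE [RHS]mxE.
  rewrite [H' i j]mxE [_ 0 j]mxE [_ 0 i]mxE.
  case: ifP => [/(fingraph.rootP csym) ij|_]; last by rewrite mul0r mulr0.
  by rewrite /c ij mulrC.
have [|A B SA SB|W uW WS] := @codiagonalization _ _ ([set h'] `|` [set dg E c]).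
- by move=> A B [->|->] [->|->] //; rewrite cm'.
- by case: SA SB => [->|->] [->|->]; rewrite ?hh' ?cc' // cm'.
have [a ha] := WS h' (or_introl erefl).
have [g hg] := WS (dg E c) (or_intror erefl).
have areal k : a k = (complex.Re (a k))%:C.
  have := hh'; rewrite ha dg_tC => /(dg_inj uW) /(congr1 (fun f => f k)) /=.
  by move=> /CrealP; case: (a k) => p q; rewrite complex_real /= => /eqP ->.
exists W, (fun k => complex.Re (a k)); split => //.
  have -> : dg W (fun k => (complex.Re (a k))%:C) = h'.
    by rewrite ha; congr dg; apply/funext => k; rewrite -areal.
  have -> : h - h' = E^t* *m (H - H') *m E.
    rewrite mulmxBr mulmxBl -/h' /H !mulmxA unitaryVm // mul1mx -mulmxA unitaryVm //.
    by rewrite mulmx1.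
  apply: le_trans (nrm_mulUr _ uE) _; rewrite exprS -mulrA.
  apply: ler_wpM2l; first exact: unK_ge0.
  have uE' := unitary_tC uE.
  apply: le_trans (nrm_mulUl _ uE') _; rewrite expr2 -mulrA.
  apply: ler_wpM2l; first exact: unK_ge0.
  apply: nrm_le_unK => // i j; rewrite [X in nc X]mxE [(- H') i j]mxE [H' i j]mxE.
  case: ifP => [_|/negbT ij]; first by rewrite subrr nc0.
  by rewrite subr0; apply: hoff; apply: contraNN ij; exact: connect1.
move=> x.
(* [f] recovers the value of [x] at the root from the cluster number; the default 0 is for complex
   numbers that are no cluster number. *)
pose f (z : R[i]) := if [pick k | c k == z] is Some k then x (fingraph.root e k) else 0.
exists (f \o g); rewrite -(dg_fun f uE uW hg); congr dg; apply/funext => k /=.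
rewrite /f; case: pickP => [l /eqP|/(_ k)]; last by rewrite eqxx.
by rewrite /c => /eqP; rewrite eqr_nat => /eqP/val_inj ->.
Qed.

Lemma approximate_codiag (d : R) : 0 < d -> exists2 delta : R, 0 < delta &
  forall S F u, u \is unitarymx -> F `<=` S ->
  (forall A B, S A -> S B -> A *m B = B *m A) -> (forall A, S A -> S (A^t*)) ->
  (forall A, F A -> cm u A <= delta) ->
  exists W (a : 'I_n -> R), [/\ W \is unitarymx, nrm (u - dg W (fun k => cis (a k))) <= d,
    forall A, F A -> exists x, nrm (A - dg W x) <= d &
    (forall A, S A -> u *m A = A *m u) ->
     u = dg W (fun k => cis (a k)) /\ forall A, S A -> exists x, A = dg W x].
Proof.
move=> d0; have K1 : 1 <= K by exact: unK_ge1.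
have K0 : 0 < K by exact: lt_le_trans K1.
have C0 : 0 <= gapC R n by exact: gapC_ge0.
(* Clusters have diameter at most [n * eta], and [nrm_dg] costs [K ^+ 3]; the successor keeps the
   denominator positive. *)
pose eta := d / (K ^+ 3 * n.+1%:R).
have eta0 : 0 < eta by apply: divr_gt0 => //; apply: mulr_gt0 => //; exact: exprn_gt0.
(* The 13 powers of [K]: 4 for passing to the logarithm, 2 for its entries in the basis [E], 3 for
   the block part, 4 for returning to the exponential. Adding 1 to [gapC] keeps the denominator
   positive. *)
pose delta := d * eta / (K ^+ 13 * (gapC R n + 1)).
have Cp : 0 < gapC R n + 1 by rewrite ltr_wpDl.
have delta0 : 0 < delta.
  by apply: divr_gt0; apply: mulr_gt0 => //; exact: exprn_gt0.
exists delta => // S F u uu FS cS sS hF.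
(* Exact commutation is treated apart: cutting a logarithm down to clusters yields estimates only,
   while the last clause demands equalities. *)
have [uS|nuS] := pselect (forall A, S A -> u *m A = A *m u).
  have [W [a [uW ua WS]]] := exact_codiag uu cS sS uS.
  exists W, a; split => //; first by rewrite -ua subrr nrm0 ltW.
  by move=> A /FS /WS [x Ax]; exists x; rewrite -Ax subrr nrm0 ltW.
(* With no further matrices, this diagonalizes [u] alone. The branch of its logarithm cut in a gap
   is the self-adjoint [h], whose commutators [transfer] bounds by those of [u]. *)
have [//|//|//|Z [a0 [uZ uz _]]] := @exact_codiag set0 u uu.
have [m hm] := gap_lift a0; rewrite card_ord in hm.
pose b k := unwind (a0 k) (m k).
pose h := dg Z (fun k => (b k)%:C).
have hh : h^t* = h.
  by rewrite dg_tC; congr dg; apply/funext => k; rewrite conj_Creal // complex_real.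
have hA A : F A -> nrm (A *m h - h *m A) <= gapC R n * K ^+ 4 * delta.
  move=> FA; rewrite nrmC /h.
  apply: le_trans (transfer (x := fun k => cis (a0 k)) (y := fun k => cis (a0 k)) A uZ uZ C0 _) _.
    by move=> i j; rewrite nc_realB; exact: hm.
  apply: ler_wpM2l; first by rewrite mulr_ge0 // exprn_ge0 // ltW.
  by rewrite -uz; exact: hF.
have [|E uE ES] := codiagonalization cS; first by move=> A B SA /sS; exact: cS.
(* If two indices are not linked, some [A] in [F] separates them by more than [eta]; the entry of
   [A h - h A] there is this separation times the entry of [h], so [h] is small between indices that
   are not linked. *)
pose e (k l : 'I_n) := `[< forall A x, F A -> A = dg E x -> nc (x k - x l) <= eta >].
have esym i j : e i j = e j i.
  by apply/asboolP/asboolP => H A x FA Ax; rewrite -ncN opprB; exact: (H A).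
have [||W [a [uW hW We]]] :=
  @block_part e E h (K ^+ 2 * (gapC R n * K ^+ 4 * delta) / eta) uE hh esym.
- have K0' := ltW K0; apply: divr_ge0; last exact: ltW.
  apply: mulr_ge0; first exact: exprn_ge0.
  by apply: mulr_ge0; [apply: mulr_ge0 => //; exact: exprn_ge0 | exact: ltW].
- move=> i j /asboolPn /existsNP [A /existsNP [x /not_implyP [FA /not_implyP [Ax /negP]]]].
  rewrite -ltNge => xij; rewrite ler_pdivlMr //.
  have := dg_entry h x x i j uE uE; rewrite -Ax => hij.
  have := entry_le_nrm (E *m (A *m h - h *m A) *m E^t*) i j; rewrite hij ncM => H.
  apply: (@le_trans _ _ (nrm (E *m (A *m h - h *m A) *m E^t*))).
    apply: le_trans H; rewrite mulrC; apply: ler_wpM2r; [exact: nc_ge0 | exact: ltW].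
  have uE' := unitary_tC uE.
  apply: le_trans (nrm_mulUr _ uE') _; rewrite expr2 -mulrA.
  apply: ler_wpM2l; first exact: unK_ge0.
  apply: le_trans (nrm_mulUl _ uE) _.
  by apply: ler_wpM2l; [exact: unK_ge0 | exact: hA].
exists W, a; split => //.
- rewrite uz.
  have -> : dg Z (fun k => cis (a0 k)) = dg Z (fun k => cis (b k)).
    by congr dg; apply/funext => k; rewrite /b cis_unwind.
  have := transfer1 (x := fun k => (b k)%:C) (y := fun k => (a k)%:C)
    (x' := fun k => cis (b k)) (y' := fun k => cis (a k)) (C := 1) uZ uW ler01.
  rewrite -/h -/K => t; apply: le_trans (t _) _.
    by move=> i j; rewrite nc_realB mul1r; exact: cis_lip.
  rewrite mul1r; apply: (@le_trans _ _ (K ^+ 4 * (K ^+ 3 *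
      (K ^+ 2 * (gapC R n * K ^+ 4 * delta) / eta)))).
    by apply: ler_wpM2l => //; rewrite exprn_ge0 // ltW.
  have -> : K ^+ 4 * (K ^+ 3 * (K ^+ 2 * (gapC R n * K ^+ 4 * delta) / eta)) =
      d * (gapC R n / (gapC R n + 1)).
    by rewrite /delta; field; rewrite !gt_eqF.
  by rewrite ger_pMr // ler_pdivrMr // mul1r lerDl.
- move=> A FA; have [x Ax] := ES A (FS A FA); have [y hy] := We x.
  exists y; rewrite -hy Ax dgB.
  apply: (@le_trans _ _ (K ^+ 3 * (n%:R * eta))).
    apply: (nrm_dg uE) => [|k]; first exact: (mulr_ge0 (ler0n _ n) (ltW eta0)).
    rewrite /=; apply: (@connect_dist e x eta) => //; first exact: ltW.
      by move=> i j /asboolP H; exact: (H A x FA Ax).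
    exact: connect_root.
  apply: (@le_trans _ _ (K ^+ 3 * (n.+1%:R * eta))).
    by rewrite ler_pM2l ?exprn_gt0 // ler_pM2r // ler_nat.
  by rewrite /eta mulrA mulrC divfK // gt_eqF //; apply: mulr_gt0 => //; exact: exprn_gt0.
Qed.

End ApproximateDiagonalization.

(** * Loops around projections, with arbitrary winding *)

Section Loops.
Variables (R : realType) (n : nat).
Implicit Types (A p W : 'M[R[i]]_n) (z : R[i]).
Let K := unK R n.

(** For a projection [p], multiplication by [z] on its range and by 1 on the complement: the
    exponential [exp (i b p)] when [z = cis b]. *)
Definition loop z p : 'M[R[i]]_n := 1%:M + (z - 1) *: p.

Lemma loop_unitary z p : p^t* = p -> p *m p = p -> z * z^*%R = 1 ->
  loop z p \is unitarymx.
Proof.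
move=> ph pp zz; apply/unitarymxP.
have -> : (loop z p)^t* = 1%:M + (z^*%R - 1) *: p.
  apply/matrixP => i j; rewrite /loop -[in RHS]ph !mxE rmorphD rmorphM rmorphB /=.
  by rewrite conjC1 conjC_nat eq_sym.
rewrite /loop mulmxDl mul1mx mulmxDr mulmx1 -scalemxAl -scalemxAr pp scalerA.
rewrite -addrA -!scalerDl.
have -> : z^*%R - 1 + (z - 1 + (z - 1) * (z^*%R - 1)) = z * z^*%R - 1 by ring.
by rewrite zz subrr scale0r addr0.
Qed.

Lemma cm_loop z p A : nc z = 1 -> cm (loop z p) A <= 2 * cm p A.
Proof.
move=> z1; rewrite /cm /loop.
have -> : (1%:M + (z - 1) *: p) *m A - A *m (1%:M + (z - 1) *: p) =
    (z - 1) *: (p *m A - A *m p).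
  rewrite mulmxDl mulmxDr mul1mx mulmx1 opprD addrACA subrr add0r.
  by rewrite -scalemxAl -scalemxAr -scalerBr.
rewrite nrmZ; apply: ler_wpM2r; first exact: nrm_ge0.
by apply: le_trans (ncD _ _) _; rewrite ncN nc1 z1.
Qed.

Definition prow W k : 'M[R[i]]_n := (row k W)^t* *m row k W.

Lemma loop_prow W k z : W \is unitarymx ->
  loop z (prow W k) = dg W (fun j => if k == j then z else 1).
Proof.
move=> uW; rewrite /loop /prow -(dg_cst 1 uW) !dg_sum.
rewrite (bigD1 k) //= [RHS](bigD1 k) //= eqxx addrAC -scalerDl addrCA subrr addr0.
by congr (_ + _); apply: eq_bigr => j /negbTE; rewrite eq_sym => ->.
Qed.

Lemma big_dg W (I : Type) (s : seq I) (f : I -> 'I_n -> R[i]) : W \is unitarymx ->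
  \big[mulmx/1%:M]_(k <- s) dg W (f k) = dg W (fun j => \prod_(k <- s) f k j).
Proof.
move=> uW; elim: s => [|k s IH].
  by rewrite big_nil -(dg_cst 1 uW); congr dg; apply/funext => j; rewrite big_nil.
by rewrite big_cons IH dgM //; congr dg; apply/funext => j; rewrite big_cons.
Qed.

Lemma big_unitary (I : Type) (s : seq I) (f : I -> 'M[R[i]]_n) :
  (forall k, f k \is unitarymx) -> \big[mulmx/1%:M]_(k <- s) f k \is unitarymx.
Proof.
move=> uf; elim/big_ind: _ => [|A B|k _]; first exact: unitary1.
  exact: mul_unitarymx.
exact: uf.
Qed.

(** The recursion that the Leibniz bound [cmM] imposes on the commutator of a product of [m]
    unitaries. *)
Fixpoint prodC (m : nat) : R := if m is m'.+1 then K * (1 + prodC m') else 0.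

Lemma prodC_ge0 m : 0 <= prodC m.
Proof.
by elim: m => //= m IH; rewrite mulr_ge0 ?addr_ge0 //; exact: unK_ge0.
Qed.

Lemma cm_big (I : Type) (s : seq I) (f : I -> 'M[R[i]]_n) A d :
  (forall k, f k \is unitarymx) -> (forall k, cm (f k) A <= d) ->
  cm (\big[mulmx/1%:M]_(k <- s) f k) A <= prodC (size s) * d.
Proof.
move=> uf hf; elim: s => [|k s IH].
  by rewrite big_nil /cm mul1mx mulmx1 subrr nrm0 mul0r.
rewrite big_cons; apply: le_trans (cmM _ _ _) _; rewrite ?big_unitary //=.
rewrite -mulrA; apply: ler_wpM2l; first exact: unK_ge0.
by rewrite mulrDl mul1r; apply: lerD.
Qed.

Lemma mcts_big (T : topologicalType) (I : Type) (s : seq I) (f : I -> T -> 'M[R[i]]_n) :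
  (forall k, mcts (f k)) -> mcts (fun t => \big[mulmx/1%:M]_(k <- s) f k t).
Proof.
move=> cf; elim: s => [|k s IH].
  have -> : (fun t => \big[mulmx/1%:M]_(k <- [::]) f k t) = (fun=> 1%:M : 'M[R[i]]_n).
    by apply/funext => t; rewrite big_nil.
  exact: mcts_cst.
have -> : (fun t => \big[mulmx/1%:M]_(l <- k :: s) f l t) =
    (fun t => f k t *m \big[mulmx/1%:M]_(l <- s) f l t).
  by apply/funext => t; rewrite big_cons.
exact: mctsM.
Qed.

Lemma prod_cis (I : Type) (s : seq I) (g : I -> R) :
  \prod_(k <- s) cis (g k) = cis (\sum_(k <- s) g k).
Proof.
elim: s => [|k s IH]; first by rewrite !big_nil cis0.
by rewrite !big_cons cisD IH.
Qed.

End Loops.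

(** * Turning a rank one projection into another *)

Section RankOnePath.
Variables (R : realType) (n : nat) (W W' : 'M[R[i]]_n).
Hypotheses (uW : W \is unitarymx) (uW' : W' \is unitarymx).
Variables (k l : 'I_n).
Implicit Types t : R.
Let K := unK R n.

Let c : R[i] := (W *m W'^t*) k l.

Let w := row k W.
Let w' := row l W'.

(* The factor [c] aligns the phase of [w'] with that of [w], so that the path
   from [w] to a multiple of [w'] stays away from [0]. *)
Definition rvec t : 'rV[R[i]]_n := (1 - t)%:C *: w + (t%:C * c) *: w'.

(** The squared length of [rvec t]. As [2 t (1 - t) + t ^ 2 = 1 - (1 - t) ^ 2], it is a convex
    combination of 1 and the squared overlap, which gives the lower bound [rsqn_ge]. *)
Definition rsqn t : R := (1 - t) ^+ 2 + (t * (1 - t) *+ 2 + t ^+ 2) * nc c ^+ 2.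

Definition rproj t : 'M[R[i]]_n := ((rsqn t)^-1)%:C *: ((rvec t)^t* *m rvec t).

Let row_one (V : 'M[R[i]]_n) j : V \is unitarymx -> row j V *m (row j V)^t* = 1%:M.
Proof.
move=> uV; apply/matrixP => a b; rewrite !ord1.
have /matrixP /(_ j j) := unitarymxP uV; rewrite !mxE !eqxx => <-.
by apply: eq_bigr => i _; rewrite !mxE.
Qed.

Let w_w' : w *m w'^t* = c%:M.
Proof.
apply/matrixP => a b; rewrite !ord1 /c !mxE eqxx mulr1n.
by apply: eq_bigr => i _; rewrite !mxE.
Qed.

Let w'_w : w' *m w^t* = (c^*%R)%:M.
Proof.
have := congr1 (fun M => M^t*) w_w'; rewrite tC_mul trmxCK => ->.
by apply/matrixP => a b; rewrite !ord1 !mxE eqxx !mulr1n.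
Qed.

Let c1 : nc c <= 1.
Proof. exact: unitary_entry (mul_unitarymx uW (unitary_tC uW')). Qed.

Lemma rvec_tC t : (rvec t)^t* = (1 - t)%:C *: w^t* + (t%:C * c^*%R) *: w'^t*.
Proof.
have cr (x : R) : ((x%:C)^*)%R = x%:C by rewrite conj_Creal // complex_real.
by apply/matrixP => i j; rewrite !mxE rmorphD !rmorphM /= !cr.
Qed.

Lemma rvec_sqn t : rvec t *m (rvec t)^t* = (rsqn t)%:C%:M.
Proof.
rewrite rvec_tC mulmxDl !mulmxDr -!scalemxAl -!scalemxAr.
rewrite /w /w' row_one // row_one // -/w -/w' w_w' w'_w !scalerA !scale_scalar_mx !mulr1.
rewrite -!raddfD /=; congr (_%:M).
have -> : (rsqn t)%:C = (1 - t)%:C * (1 - t)%:C +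
    (t%:C * (1 - t)%:C *+ 2 + t%:C * t%:C) * (c * c^*%R).
  rewrite -nc_sqr -!rmorphM /= -rmorphMn /= -rmorphD /= -rmorphM /= -rmorphD /=.
  by rewrite /rsqn !expr2.
by ring.
Qed.

Lemma rsqn_ge t : 0 <= t <= 1 -> nc c ^+ 2 <= rsqn t.
Proof.
move=> /andP[t0 t1]; have h : nc c ^+ 2 <= 1 by rewrite expr_le1 // nc_ge0.
rewrite /rsqn; have := sqr_ge0 (nc c); move: (nc c ^+ 2) h => x x1 x0.
have : 0 <= (1 - t) ^+ 2 * (1 - x) by rewrite mulr_ge0 ?sqr_ge0 ?subr_ge0.
by nra.
Qed.

Hypothesis c0 : 0 < nc c.

Let rsqn_gt0 t : 0 <= t <= 1 -> 0 < rsqn t.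
Proof. by move=> /rsqn_ge; apply: lt_le_trans; rewrite exprn_gt0. Qed.

Lemma rproj_tC t : (rproj t)^t* = rproj t.
Proof.
have cr (x : R) : ((x%:C)^*)%R = x%:C by rewrite conj_Creal // complex_real.
have h : ((rvec t)^t* *m rvec t)^t* = (rvec t)^t* *m rvec t by rewrite tC_mul trmxCK.
apply/matrixP => i j; rewrite -[in RHS]/(rproj t) /rproj -[in RHS]h.
move: ((rvec t)^t* *m rvec t) (_^-1) => M x.
by rewrite !mxE rmorphM /= cr.
Qed.

Lemma rproj_idem t : 0 <= t <= 1 -> rproj t *m rproj t = rproj t.
Proof.
move=> /rsqn_gt0 s0; rewrite /rproj -scalemxAl -scalemxAr scalerA.
rewrite mulmxA -(mulmxA _ (rvec t)) rvec_sqn mul_mx_scalar -scalemxAl scalerA.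
congr (_ *: _); rewrite -!rmorphM /=; congr (_%:C).
by rewrite mulfVK // gt_eqF.
Qed.

Lemma rproj0 : rproj 0 = prow W k.
Proof.
have r0 : rsqn 0 = 1 by rewrite /rsqn; ring.
have v0 : rvec 0 = w.
  by rewrite /rvec subr0 [0%:C]rmorph0 [1%:C]rmorph1 mul0r scale0r addr0 scale1r.
by rewrite /rproj r0 v0 invr1 [1%:C]rmorph1 scale1r.
Qed.

Lemma rproj1 : rproj 1 = prow W' l.
Proof.
have r1 : rsqn 1 = nc c ^+ 2 by rewrite /rsqn; ring.
have v1 : rvec 1 = c *: w'.
  by rewrite /rvec subrr [0%:C]rmorph0 [1%:C]rmorph1 scale0r add0r mul1r.
have v1' : (rvec 1)^t* = c^*%R *: w'^t*.
  by rewrite rvec_tC subrr [0%:C]rmorph0 [1%:C]rmorph1 scale0r add0r mul1r.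
rewrite /rproj r1 v1' v1 -scalemxAl -scalemxAr !scalerA.
rewrite -mulrA [c^*%R * c]mulrC -nc_sqr -rmorphM /= mulVf ?gt_eqF ?exprn_gt0 //.
by rewrite [1%:C]rmorph1 scale1r.
Qed.

Lemma mcts_rproj (T : topologicalType) (f : T -> R) :
  (forall x, 0 <= f x <= 1) -> continuous f -> mcts (fun x => rproj (f x)).
Proof.
move=> f01 cf.
have cC (h : T -> R) : continuous h -> ccts (fun x => (h x)%:C).
  by move=> ch; apply: ccts_ReIm => // x; exact: cvg_cst.
have cM : continuous (fun x => 1 - f x) by move=> x; apply: cvgB; [exact: cvg_cst | exact: cf].
have cV : mcts (fun x => rvec (f x)).
  apply: mctsD; first by apply: mctsZ; [exact: cC | exact: mcts_cst].
  have -> : (fun x => ((f x)%:C * c) *: w') = (fun x => (f x)%:C *: (c *: w')).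
    by apply/funext => x; rewrite scalerA.
  by apply: mctsZ; [exact: cC | exact: mcts_cst].
apply: mctsZ; last by apply: mctsM => //; exact: mcts_tC.
apply: cC => x; apply: cvgV; first by rewrite gt_eqF // rsqn_gt0.
rewrite /rsqn; apply: cvgD; first by apply: cvgM; exact: cM.
apply: cvgM; last exact: cvg_cst.
apply: cvgD; last by apply: cvgM; exact: cf.
by apply: cvgD; apply: cvgM; try exact: cM; exact: cf.
Qed.

Let nrm_row (V : 'M[R[i]]_n) j : V \is unitarymx -> nrm (row j V) <= K.
Proof.
move=> uV; apply: (@le_trans _ _ ((1 * n)%:R * 1)).
  by apply: nrm_le_entries => a b; rewrite mxE; exact: unitary_entry.
by rewrite mulr1 mul1n /K unK.unlock ler_nat -mulnn (leq_trans (leqnSn n)) // leq_pmulr.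
Qed.

(** Both vectors are approximate eigenvectors. Pairing [w A] with [w'] in two ways shows that [c]
    times the difference of their eigenvalues is small. Since [w'] enters [rvec t] with the factor
    [t c], all of [rvec t] is almost an eigenvector for [x k]; only the normalization costs the
    inverse square of the overlap. *)
Lemma cm_rproj A x x' d t : 0 <= t <= 1 ->
  nrm (A - dg W x) <= d -> nrm (A - dg W' x') <= d ->
  cm (rproj t) A <= 16 * K ^+ 4 / nc c ^+ 2 * d.
Proof.
move=> t01; have /andP[t0 t1] := t01.
set E := A - dg W x; set E' := A - dg W' x' => hE hE'.
have d0 : 0 <= d by exact: le_trans (nrm_ge0 E) hE.
have K1 : 1 <= K by exact: unK_ge1.
have K0 : 0 <= K by exact: unK_ge0.
have AE : A = dg W x + E by rewrite addrC subrK.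
have AE' : A = dg W' x' + E' by rewrite addrC subrK.
have wA : w *m A = x k *: w + w *m E by rewrite AE mulmxDr row_dg.
have wA' : w' *m A = x' l *: w' + w' *m E' by rewrite AE' mulmxDr row_dg.
have Aw : A *m w^t* = x k *: w^t* + E *m w^t* by rewrite AE mulmxDl dg_col.
have Aw' : A *m w'^t* = x' l *: w'^t* + E' *m w'^t* by rewrite AE' mulmxDl dg_col.
clear AE AE'; clearbody E E'.
have nw : nrm w <= K by exact: nrm_row.
have nw' : nrm w' <= K by exact: nrm_row.
set y := x' l - x k.
have wEw' (Z : 'M[R[i]]_n) : nrm Z <= d -> nrm (w *m Z *m w'^t*) <= K ^+ 2 * d.
  move=> hZ; apply: le_trans (nrmM _ _) _; rewrite nrm_tC expr2 -mulrA [K * (K * d)]mulrC.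
  apply: ler_pM; rewrite ?nrm_ge0 //; apply: le_trans (nrmM _ _) _.
  by apply: ler_pM; rewrite ?nrm_ge0.
have ncy : nc (c * y) <= 2 * K ^+ 2 * d.
  have e : (c * y)%:M = w *m E *m w'^t* - w *m E' *m w'^t*.
    have h : w *m A *m w'^t* = w *m (A *m w'^t*) by rewrite mulmxA.
    rewrite wA Aw' mulmxDl mulmxDr -scalemxAl -scalemxAr w_w' !scale_scalar_mx mulmxA in h.
    rewrite mulrC /y mulrBl raddfB /=; apply/eqP.
    by rewrite subr_eq addrAC eq_sym subr_eq [X in X == _]addrC h.
  have h : nc (c * y) <= nrm ((c * y)%:M : 'M[R[i]]_1).
    by have := entry_le_nrm ((c * y)%:M : 'M[R[i]]_1) 0 0; rewrite mxE eqxx mulr1n.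
  apply: le_trans h _; rewrite e; apply: le_trans (nrmB _ _) _.
  by have := wEw' _ hE; have := wEw' _ hE'; lra.
have ncJy : nc (c^*%R * y) <= 2 * K ^+ 2 * d by move: ncy; rewrite !ncM ncJ.
have rv : nrm (rvec t) <= 2 * K.
  apply: le_trans (nrmD _ _) _; rewrite !nrmZ ncM !nc_real !ger0_norm ?subr_ge0 //.
  have -> : 2 * K = 1 * K + 1 * K by ring.
  apply: lerD; first by apply: ler_pM; rewrite ?nrm_ge0 ?subr_ge0 //; lra.
  apply: ler_pM; rewrite ?nrm_ge0 ?mulr_ge0 ?nc_ge0 //.
  by rewrite -[leRHS]mul1r; apply: ler_pM; rewrite ?nc_ge0.
pose D := 4 * K ^+ 3 * d.
have hD : K * d + (2 * K ^+ 2 * d * K + K * d) <= D.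
  have : K * d <= K ^+ 3 * d.
    by apply: ler_wpM2r => //; rewrite -[leLHS]mulr1 exprS ler_wpM2l // exprn_ege1.
  rewrite /D => h; have -> : 2 * K ^+ 2 * d * K = 2 * (K ^+ 3 * d) by ring.
  by lra.
have split_bound (m1 m2 : nat) (Z1 Z2 Z3 : 'M[R[i]]_(m1, m2)) (a b : R[i]) :
    nc a <= 1 -> nc b <= 2 * K ^+ 2 * d -> nrm Z1 <= K * d -> nrm Z2 <= K ->
    forall a', nc a' <= 1 -> nrm Z3 <= K * d -> 
    nrm (a *: Z1 + t%:C *: (b *: Z2 + a' *: Z3)) <= D.
  move=> ha hb h1 h2 a' ha' h3; apply: le_trans hD; apply: le_trans (nrmD _ _) _.
  rewrite !nrmZ nc_real ger0_norm //; apply: lerD.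
    by rewrite -[leRHS]mul1r; apply: ler_pM; rewrite ?nc_ge0 ?nrm_ge0.
  apply: (@le_trans _ _ (1 * nrm (b *: Z2 + a' *: Z3))).
    by apply: ler_wpM2r => //; exact: nrm_ge0.
  rewrite mul1r; apply: le_trans (nrmD _ _) _; rewrite !nrmZ; apply: lerD.
    by apply: ler_pM; rewrite ?nc_ge0 ?nrm_ge0.
  by rewrite -[leRHS]mul1r; apply: ler_pM; rewrite ?nc_ge0 ?nrm_ge0.
have nc1t : nc (1 - t)%:C <= 1 by rewrite nc_real ger0_norm ?subr_ge0 //; lra.
have hM (m1 m2 m3 : nat) (X : 'M[R[i]]_(m1, m2)) (Y : 'M[R[i]]_(m2, m3)) a b :
    nrm X <= a -> nrm Y <= b -> nrm (X *m Y) <= a * b.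
  by move=> hX hY; apply: le_trans (nrmM _ _) _; apply: ler_pM; rewrite ?nrm_ge0.
have rA : nrm (rvec t *m A - x k *: rvec t) <= D.
  have -> : rvec t *m A - x k *: rvec t =
      (1 - t)%:C *: (w *m E) + t%:C *: ((c * y) *: w' + c *: (w' *m E')).
    rewrite /rvec mulmxDl -!scalemxAl wA wA' /y.
    by apply/matrixP => i j; rewrite !mxE; move: (\sum_(_ < _) _) (\sum_(_ < _) _) => p q; ring.
  by apply: split_bound => //; apply: hM.
have Ar : nrm (A *m (rvec t)^t* - x k *: (rvec t)^t*) <= D.
  have -> : A *m (rvec t)^t* - x k *: (rvec t)^t* =
      (1 - t)%:C *: (E *m w^t*) + t%:C *: ((c^*%R * y) *: w'^t* + c^*%R *: (E' *m w'^t*)).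
    rewrite rvec_tC mulmxDr -!scalemxAr Aw Aw' /y.
    move: (w^t*) (w'^t*) (E' *m _) (E *m _) => r s q p.
    move: (c^*%R) (x' l) (x k) (t%:C) ((1 - t)%:C) => f a b g h.
    apply/matrixP => i j; rewrite !mxE.
    by move: (p i j) (q i j) (r i j) (s i j) => ? ? ? ?; ring.
  apply: split_bound; rewrite ?ncJ ?nrm_tC //.
    by rewrite mulrC; apply: hM; rewrite ?nrm_tC.
  by rewrite mulrC; apply: hM; rewrite ?nrm_tC.
(* The same eigenvalue [x k] is subtracted on both sides, so the commutator consists of the two
   defects only. *)
have e : rproj t *m A - A *m rproj t = ((rsqn t)^-1)%:C *:
    ((rvec t)^t* *m (rvec t *m A - x k *: rvec t) -
     (A *m (rvec t)^t* - x k *: (rvec t)^t*) *m rvec t).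
  rewrite /rproj -scalemxAl -scalemxAr -scalerBr; congr (_ *: _).
  rewrite mulmxBr mulmxBl !mulmxA -scalemxAr -scalemxAl.
  by rewrite opprB addrA subrK.
have s0 := rsqn_gt0 t01.
have s0' : 0 <= (rsqn t)^-1 by rewrite invr_ge0; exact: ltW.
rewrite /cm e nrmZ nc_real (ger0_norm s0') mulrC.
(* Two products of a vector of norm at most [2 * K] with a defect of norm at most [D = 4 K^3 d] give
   the constant [16 K^4]. *)
apply: (@le_trans _ _ ((2 * K * D + D * (2 * K)) / nc c ^+ 2)).
  apply: ler_pM; rewrite ?nrm_ge0 //.
    apply: le_trans (nrmB _ _) _; apply: lerD; apply: hM => //.
    by rewrite nrm_tC.
  by rewrite lef_pV2 ?posrE ?exprn_gt0 //; exact: rsqn_ge.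
by rewrite /D le_eqVlt; apply/orP; left; apply/eqP; ring.
Qed.

End RankOnePath.

(** A row of the unitary [W W'^t*] has length 1, so its [n] squared moduli cannot all lie below
    [1 / (n + 1)]. *)
Lemma exists_overlap (R : realType) (n : nat) (W W' : 'M[R[i]]_n) (k : 'I_n) :
  W \is unitarymx -> W' \is unitarymx ->
  exists l, (n.+1%:R)^-1 <= nc ((W *m W'^t*) k l) ^+ 2.
Proof.
move=> uW uW'; apply: contrapT => /forallNP h.
have uV := mul_unitarymx uW (unitary_tC uW').
move: (W *m W'^t*) uV h => V uV h.
have /matrixP /(_ k k) := unitarymxP uV; rewrite !mxE eqxx => e.
have {e} : \sum_l nc (V k l) ^+ 2 = 1.
  apply: complexI; rewrite rmorph_sum /= -[RHS]e; apply: eq_bigr => l _.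
  by rewrite nc_sqr !mxE.
move=> e; have : \sum_l nc (V k l) ^+ 2 <= \sum_(l < n) (n.+1%:R)^-1.
  by apply: ler_sum => l _; have /negP := h l; rewrite -ltNge => /ltW.
rewrite e sumr_const card_ord -[_ *+ n]mulr_natl ler_pdivlMr ?ltr0n //.
by rewrite mul1r ler_nat ltnn.
Qed.

(** * Homotopy between the exponentials of neighbouring nodes *)

Section Homotopy.
Variables (R : realType) (n : nat).
Implicit Types (A W u : 'M[R[i]]_n) (a : 'I_n -> R) (r t d : R).
Let K := unK R n.

(** Distance of the two exponentials for the common branch, in units of [d]: [gapC] belongs to the
    [2 n] arguments, [K ^+ 4] to [transfer1], and 2 to the detour through [u]. *)
Definition logK : R := gapC R (n + n) * K ^+ 4 * 2.

Definition homK : R := 1 + 2 * K ^+ 3 * logK.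

(** From [cmM]: [2 * K] for an exponential, the [cayC] term for the contracted quotient of two
    exponentials, the [prodC] term for [n] loops, where [n.+1] bounds the inverse squared
    overlap. *)
Definition homCm : R := K * (K * (2 * K + cayC R n * (K * (4 * K))) +
  prodC R n n * (2 * (16 * K ^+ 4 * n.+1%:R))).

Definition expath W a r : 'M[R[i]]_n := dg W (fun k => cis (r * a k)).

Lemma expath_unitary W a r : W \is unitarymx -> expath W a r \is unitarymx.
Proof. exact: dg_cis_unitary. Qed.

Lemma expath0 W a : W \is unitarymx -> expath W a 0 = 1%:M.
Proof.
move=> uW; rewrite /expath -(dg_cst 1 uW); congr dg; apply/funext => k.
by rewrite mul0r cis0.
Qed.

Lemma expath1 W a : expath W a 1 = dg W (fun k => cis (a k)).
Proof. by rewrite /expath; congr dg; apply/funext => k; rewrite mul1r. Qed.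

Lemma mcts_expath (T : topologicalType) W a (f : T -> R) :
  continuous f -> mcts (fun x => expath W a (f x)).
Proof.
move=> cf; rewrite /expath.
have -> : (fun x => dg W (fun k => cis (f x * a k))) =
    (fun x => W^t* *m (dg 1%:M (fun k => cis (f x * a k))) *m W).
  by apply/funext => x; rewrite dg.unlock trmx1 map_mx1 mul1mx mulmx1.
apply: mctsM; last exact: mcts_cst.
apply: mctsM; first exact: mcts_cst.
apply: mcts_entries => i j.
have -> : (fun x => dg 1%:M (fun k => cis (f x * a k)) i j) =
    (fun x => if i == j then cis (f x * a i) else 0).
  apply/funext => x; rewrite dg.unlock trmx1 map_mx1 mul1mx mulmx1 !mxE.
  by case: eqP => _; rewrite ?mulr1n ?mulr0n.
case: (i == j); last exact: ccts_cst.
by apply: ccts_cis => x; apply: cvgM; [exact: cf | exact: cvg_cst].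
Qed.

Lemma cm_dg W x A y d : W \is unitarymx -> dg W x \is unitarymx ->
  nrm (A - dg W y) <= d -> cm (dg W x) A <= 2 * K * d.
Proof.
move=> uW uX hA; apply: le_trans (cm_near _ (dg W y) _) _.
rewrite /cm (dgM _ _ uW) (dgM _ _ uW).
have -> : (fun k => x k * y k) = (fun k => y k * x k).
  by apply/funext => k; rewrite mulrC.
rewrite subrr nrm0 add0r; apply: ler_pM; rewrite ?mulr_ge0 ?nrm_ge0 //.
by apply: ler_wpM2l => //; exact: nrm_unitary.
Qed.

Lemma near_unitary W u : W \is unitarymx ->
  nrm (W^t* *m u - 1%:M) <= K * nrm (u - W).
Proof.
move=> uW; rewrite -(unitaryVm uW) -mulmxBr.
exact: nrm_mulUl (unitary_tC uW).
Qed.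

(** [r] scales the exponent and [t] leads from [W] to [W']. The factor [S] joins the exponentials
    for the branch cut in the common gap, and [L] restores the integer turns that this branch has
    removed. At [r = 1] all loops are trivial, so [M 1 t] stays near [u] whatever the number of
    turns. *)
Lemma branch_homotopy W W' a a' u d : W \is unitarymx -> W' \is unitarymx ->
  K * (logK * d) <= 2^-1 ->
  nrm (u - dg W (fun k => cis (a k))) <= d ->
  nrm (u - dg W' (fun k => cis (a' k))) <= d ->
  exists (b : 'I_n -> R) (M : R -> R -> 'M[R[i]]_n),
  [/\ forall l, cis (b l) = cis (a' l),
      forall r t, 0 <= r <= 1 -> 0 <= t <= 1 -> M r t \is unitarymx,
      forall (T : topologicalType) (f g : T -> R),
        (forall x, 0 <= f x <= 1) -> (forall x, 0 <= g x <= 1) ->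
        continuous f -> continuous g -> mcts (fun x => M (f x) (g x)),
      forall A x x' d' r t, 0 <= r <= 1 -> 0 <= t <= 1 ->
        nrm (A - dg W x) <= d' -> nrm (A - dg W' x') <= d' ->
        cm (M r t) A <= homCm * d' &
      [/\ forall t, 0 <= t <= 1 -> M 0 t = 1%:M,
          forall r, 0 <= r <= 1 -> M r 0 = expath W a r,
          forall r, 0 <= r <= 1 -> M r 1 = expath W' b r &
          forall v t, 0 <= t <= 1 -> nrm (v - dg W (fun k => cis (a k))) <= d ->
            nrm (v - M 1 t) <= homK * d]].
Proof.
move=> uW uW' hd hu hu'.
have K0 : 0 <= K by exact: unK_ge0.
have K1 : 1 <= K by exact: unK_ge1.
have d0 : 0 <= d by exact: le_trans (nrm_ge0 _) hu.
have C0 : 0 <= gapC R (n + n) by exact: gapC_ge0.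
(* The sum type makes one gap serve both spectra. *)
have [m hm] := gap_lift (fun k : 'I_n + 'I_n => match k with inl k => a k | inr k => a' k end).
rewrite card_sum card_ord in hm.
pose al k := unwind (a k) (m (inl k)).
pose al' k := unwind (a' k) (m (inr k)).
pose X := expath W al; pose Y := expath W' al'.
have uX r : X r \is unitarymx by exact: expath_unitary.
have uY r : Y r \is unitarymx by exact: expath_unitary.
have XY r : 0 <= r <= 1 -> nrm (Y r - X r) <= logK * d.
  move=> /andP[r0 r1]; rewrite nrmC.
  apply: le_trans (transfer1 (x := fun k => cis (a k)) (y := fun k => cis (a' k)) uW uW' C0 _) _.
    move=> i j; apply: le_trans (cis_lip _ _) _.
    rewrite -mulrBr normrM (ger0_norm r0); apply: le_trans (hm (inl i) (inr j)).
    by rewrite -[leRHS]mul1r; apply: ler_wpM2r.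
  rewrite /logK -[leRHS]mulrA; apply: ler_wpM2l; first by rewrite mulr_ge0 ?exprn_ge0.
  apply: le_trans (nrm_trans u _ _) _; rewrite nrmC.
  by have := hu; have := hu'; lra.
pose V r := (X r)^t* *m Y r.
have hV r : 0 <= r <= 1 -> nrm (V r - 1%:M) <= K * (logK * d).
  move=> r01; apply: le_trans (near_unitary _ (uX r)) _.
  by apply: ler_wpM2l => //; exact: XY.
have hV2 r : 0 <= r <= 1 -> nrm (V r - 1%:M) <= 2^-1 by move=> /hV /le_trans; apply.
have uV r : V r \is unitarymx by exact: mul_unitarymx (unitary_tC (uX r)) (uY r).
have [sig hsig] := choice (fun k => exists_overlap k uW uW').
pose c k := nc ((W *m W'^t*) k (sig k)).
have c0 k : 0 < c k.
  rewrite lt_neqAle nc_ge0 andbT; apply/eqP => c0; have := hsig k.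
  by rewrite -/(c k) -c0 expr0n /= leNgt invr_gt0 ltr0Sn.
pose P k t := rproj W W' k (sig k) t.
pose z k r : R[i] := cis (r * ((m (inl k))%:~R * (pi *+ 2))).
pose L r t := \big[mulmx/1%:M]_k loop (z k r) (P k t).
have uL1 k r t : 0 <= t <= 1 -> loop (z k r) (P k t) \is unitarymx.
  move=> t01; apply: loop_unitary; first exact: rproj_tC.
    exact: (rproj_idem uW uW' (c0 k)).
  exact: cis_mulJ.
have uL r t : 0 <= t <= 1 -> L r t \is unitarymx.
  by move=> t01; apply: big_unitary => k; exact: uL1.
have L1 r t : (forall k, z k r = 1) -> L r t = 1%:M.
  move=> z1; rewrite /L; elim/big_ind: _ => [//|A B -> ->|k _]; first exact: mulmx1.
  by rewrite /loop z1 subrr scale0r addr0.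
pose S r t := X r *m cay t (V r).
have uS r t : 0 <= r <= 1 -> 0 <= t <= 1 -> S r t \is unitarymx.
  move=> r01 t01; apply: mul_unitarymx (uX r) _.
  exact: cay_unitary (hV2 r r01) (uV r).
(* The turns of index [k] arrive at [sig k]. This map need not be injective, as the bases are not
   matched; [b j] collects all turns that arrive at [j]. *)
pose b j := al' j + \sum_k (if sig k == j then (m (inl k))%:~R * (pi *+ 2) else 0).
exists b, (fun r t => S r t *m L r t); split.
- move=> l; rewrite /b cisD cis_unwind -prod_cis big1 ?mulr1 // => k _.
  by case: eqP => _; [exact: cis2pi | exact: cis0].
- move=> r t r01 t01; exact: mul_unitarymx (uS r t r01 t01) (uL r t t01).
- move=> T f g f01 g01 cf cg.
  have cX := mcts_expath W al cf; have cY := mcts_expath W' al' cf.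
  apply: mctsM.
    apply: mctsM => //; apply: mcts_cay => //; first by move=> x; exact: hV2.
    by apply: mctsM => //; exact: mcts_tC.
  apply: mcts_big => k; apply: mctsD; first exact: mcts_cst.
  apply: mctsZ; last exact: (mcts_rproj uW uW' (c0 k)).
  apply: cctsD; last exact: ccts_cst.
  by apply: ccts_cis => x; apply: cvgM; [exact: cf | exact: cvg_cst].
- move=> A x x' d' r t r01 t01 hA hA'.
  have d'0 : 0 <= d' by exact: le_trans (nrm_ge0 _) hA.
  have cX : cm (X r) A <= 2 * K * d' by exact: cm_dg (uX r) hA.
  have cY : cm (Y r) A <= 2 * K * d' by exact: cm_dg (uY r) hA'.
  have uX' := unitary_tC (uX r).
  have cX' : cm ((X r)^t*) A <= 2 * K * d'.
    by move: uX'; rewrite /X /expath dg_tC => uX'; exact: cm_dg uX' hA.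
  have cV : cm (V r) A <= K * (4 * K * d').
    apply: le_trans (cmM _ uX' (uY r)) _; apply: ler_wpM2l => //.
    have -> : 4 * K * d' = 2 * K * d' + 2 * K * d' by ring.
    exact: (lerD cX' cY).
  have cC : cm (cay t (V r)) A <= cayC R n * (K * (4 * K * d')).
    apply: le_trans (cm_cay _ t01 (hV2 r r01)) _; apply: ler_wpM2l => //.
    by rewrite /cayC -/K addr_ge0 ?mulr_ge0 ?exprn_ge0.
  have uC := cay_unitary t01 (hV2 r r01) (uV r).
  have cS : cm (S r t) A <= K * (2 * K * d' + cayC R n * (K * (4 * K * d'))).
    apply: le_trans (cmM _ (uX r) uC) _; by apply: ler_wpM2l K0 _ _ _; exact: (lerD cX cC).
  have cL : cm (L r t) A <= prodC R n n * (2 * (16 * K ^+ 4 * n.+1%:R * d')).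
    have := @cm_big _ n _ (index_enum 'I_n) (fun k => loop (z k r) (P k t)) A
      (2 * (16 * K ^+ 4 * n.+1%:R * d')) (fun k => uL1 k r t t01).
    have -> : size (index_enum 'I_n) = n by rewrite -[RHS]card_ord cardE /enum_mem filter_predT.
    apply => k; apply: le_trans (cm_loop _ _ (nc_cis _)) _; apply: ler_wpM2l => //.
    apply: le_trans (cm_rproj uW uW' (c0 k) t01 hA hA') _.
    apply: ler_wpM2r => //; apply: ler_wpM2l; first by rewrite mulr_ge0 ?exprn_ge0.
    by rewrite invf_ple ?posrE ?ltr0Sn //; exact: exprn_gt0 (c0 k).
  apply: le_trans (cmM _ (uS r t r01 t01) (uL r t t01)) _.
  rewrite /homCm -!mulrA; apply: ler_wpM2l => //.
  by apply: le_trans (lerD cS cL) _; rewrite le_eqVlt; apply/orP; left; apply/eqP; ring.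
split.
- move=> t t01; rewrite L1 ?mulmx1 /S /V /X /Y ?expath0 //.
    by rewrite trmx1 map_mx1 mul1mx mul1mx cay_id.
  by move=> k; rewrite /z mul0r cis0.
- move=> r r01; rewrite /S cay0 ?hV2 // mulmx1 /L.
  under eq_bigr => k _ do rewrite /P rproj0 ?loop_prow //.
  rewrite big_dg // /X /expath dgM //; congr dg; apply/funext => j.
  rewrite (bigD1 j) //= eqxx big1 ?mulr1 => [|k /negbTE -> //].
  by rewrite /z -cisD -mulrDr /al /unwind subrK.
- move=> r r01; rewrite /S cay1 ?hV2 // /V mulmxA (unitarymxP (uX r)) mul1mx /L.
  under eq_bigr => k _ do rewrite /P (rproj1 (c0 k)) loop_prow //.
  rewrite big_dg // /Y /expath dgM //; congr dg; apply/funext => j.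
  rewrite [r * b j](mulrDr r (al' j)) [RHS]cisD mulr_sumr -prod_cis; congr (_ * _).
  by apply: eq_bigr => k _; case: eqP => _; rewrite // mulr0 cis0.
- move=> v t t01 hv; have r1 : 0 <= (1 : R) <= 1 by rewrite ler01 lexx.
  rewrite L1 ?mulmx1 => [|k]; last by rewrite /z mul1r cis2pi.
  have X1 : X 1 = dg W (fun k => cis (a k)).
    by rewrite /X expath1; congr dg; apply/funext => k; rewrite cis_unwind.
  apply: le_trans (nrm_trans (X 1) _ _) _; rewrite /homK mulrDl mul1r; apply: lerD.
    by rewrite X1.
  rewrite nrmC /S -[X in nrm (_ - X)]mulmx1 -mulmxBr.
  apply: le_trans (nrm_mulUl _ (uX 1)) _.
  have -> : 2 * K ^+ 3 * logK * d = K * (2 * K * (K * (logK * d))) by ring.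
  apply: ler_wpM2l => //; apply: le_trans (cay_near t01 (hV2 1 r1)) _.
  by apply: ler_wpM2l; [rewrite mulr_ge0 | exact: hV].
Qed.

End Homotopy.

(** * Truncation to an interval *)

Section Clamp.
Variable R : realType.
Implicit Types lo hi t : R.

Definition clamp lo hi t : R := Num.max lo (Num.min t hi).

Lemma clamp_itv lo hi t : lo <= hi -> lo <= clamp lo hi t <= hi.
Proof. by move=> lh; rewrite /clamp le_max lexx /= ge_max lh ge_min lexx orbT. Qed.

Lemma clamp_id lo hi t : lo <= t <= hi -> clamp lo hi t = t.
Proof. by move=> /andP[h1 h2]; rewrite /clamp (min_idPl h2) (max_idPr h1). Qed.

Lemma clamp_lo lo hi t : t <= lo -> lo <= hi -> clamp lo hi t = lo.
Proof.
by move=> h1 h2; rewrite /clamp (min_idPl (le_trans h1 h2)) (max_idPl h1).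
Qed.

Lemma clamp_continuous lo hi (T : topologicalType) (f : T -> R) :
  continuous f -> continuous (fun x => clamp lo hi (f x)).
Proof.
move=> cf x; apply: (@continuous_max R T (cst lo) (fun x => Num.min (f x) hi)).
  exact: cvg_cst.
by apply: (@continuous_min R T f (cst hi)); [exact: cf | exact: cvg_cst].
Qed.

End Clamp.

(** * The path over one short piece of the interval *)

Section Segment.
Variables (R : realType) (n : nat).
Implicit Types (A W v : 'M[R[i]]_n) (a : 'I_n -> R) (r s t d : R).
Let K := unK R n.

(** The exponential ends only near [v]; contracting the quotient along with it makes the path end
    exactly at [v] for [r = 1]. *)
Definition contraction W a v r : 'M[R[i]]_n :=
  expath W a r *m cay r ((expath W a 1)^t* *m v).

(** The path has to start at [u], where the exponent is full, and end at 1, where it vanishes;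
    clamping makes it total on the line. *)
Definition rev01 s : R := 1 - clamp 0 1 s.

Lemma rev01_itv s : 0 <= rev01 s <= 1.
Proof.
have /andP[h1 h2] := clamp_itv s (@ler01 R).
by rewrite /rev01 subr_ge0 h2 /= gerBl.
Qed.

Lemma rev01_0 : rev01 0 = 1.
Proof. by rewrite /rev01 clamp_id ?lexx ?ler01 // subr0. Qed.

Lemma rev01_1 : rev01 1 = 0.
Proof. by rewrite /rev01 clamp_id ?lexx ?ler01 // subrr. Qed.

Lemma rev01_continuous (T : topologicalType) (f : T -> R) :
  continuous f -> continuous (fun x => rev01 (f x)).
Proof. by move=> cf x; apply: cvgB; [exact: cvg_cst | exact: clamp_continuous]. Qed.

(** From [cmM] for [M] times the contraction of its adjoint times [u]: [K ^+ 2] is the cost of the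
    adjoint, and 1 stands for the commutator of [u]. *)
Definition segCm : R := K * (homCm R n + cayC R n * (K * (K ^+ 2 * homCm R n + 1))).

(** Keeps both arguments of [cay] within 1/2 of 1: the quotient of the two exponentials and that of
    [u] by [M 1]. *)
Definition small d := (K * (logK R n * d) <= 2^-1) && (K * (homK R n * d) <= 2^-1).

Let in01 : 0 <= (1 : R) <= 1.
Proof. by rewrite ler01 lexx. Qed.

Lemma segment_path (W W' : 'M[R[i]]_n) a a' (u : R -> 'M[R[i]]_n) c c' d :
  W \is unitarymx -> W' \is unitarymx -> small d -> c < c' ->
  mcts u -> (forall t, u t \is unitarymx) ->
  (forall t, c <= t <= c' -> nrm (u t - expath W a 1) <= d) ->
  (forall t, c <= t <= c' -> nrm (u t - expath W' a' 1) <= d) ->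
  exists b (U : R -> R -> 'M[R[i]]_n),
  [/\ forall l, cis (b l) = cis (a' l),
      mcts (fun x : R * R => U x.1 x.2),
      forall s t, U s t \is unitarymx,
      forall A x x' s t d', c <= t <= c' ->
        nrm (A - dg W x) <= d' -> nrm (A - dg W' x') <= d' -> cm (u t) A <= d' ->
        cm (U s t) A <= segCm * d' &
      [/\ forall t, c <= t <= c' -> U 0 t = u t,
          forall t, c <= t <= c' -> U 1 t = 1%:M,
          forall s t, t <= c -> U s t = contraction W a (u c) (rev01 s) &
          forall s, U s c' = contraction W' b (u c') (rev01 s)]].
Proof.
move=> uW uW' /andP[sm1 sm2] cc' cu uu hu hu'.
have K0 : 0 <= K by exact: unK_ge0.
have cin : c <= c <= c' by rewrite lexx ltW.
have c'in : c <= c' <= c' by rewrite lexx ltW.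
pose q t := clamp c c' t.
have qin t : c <= q t <= c' by exact: clamp_itv (ltW cc').
have hu1 t : c <= t <= c' -> nrm (u t - dg W (fun k => cis (a k))) <= d.
  by move=> /hu; rewrite expath1.
have hu1' t : c <= t <= c' -> nrm (u t - dg W' (fun k => cis (a' k))) <= d.
  by move=> /hu'; rewrite expath1.
have [b [M [ba uM cM cmM0 [M0 Mr0 Mr1 Mu]]]] :=
  branch_homotopy uW uW' sm1 (hu1 c cin) (hu1' c cin).
pose ta t := clamp 0 1 ((t - c) / (c' - c)).
have ta01 t : 0 <= ta t <= 1 by exact: clamp_itv ler01.
have cc0 : 0 < c' - c by rewrite subr_gt0.
have tac t : t <= c -> ta t = 0.
  by move=> tc; rewrite /ta clamp_lo // pmulr_lle0 ?invr_gt0 // subr_le0.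
have tac' : ta c' = 1 by rewrite /ta divff ?gt_eqF // clamp_id // lexx ler01.
(* [M 1] follows [u] only approximately; this remaining factor is contracted to 1 by [cay]. *)
pose V t := (M 1 (ta t))^t* *m u (q t).
have uM1 t : M 1 (ta t) \is unitarymx by exact: uM.
have hV t : nrm (V t - 1%:M) <= 2^-1.
  apply: le_trans (near_unitary _ (uM1 t)) _; apply: le_trans sm2.
  by apply: ler_wpM2l => //; exact: Mu (ta01 t) (hu1 _ (qin t)).
have uV t : V t \is unitarymx by exact: mul_unitarymx (unitary_tC (uM1 t)) (uu _).
pose U s t := M (rev01 s) (ta t) *m cay (rev01 s) (V t).
have uMs s t : M (rev01 s) (ta t) \is unitarymx by exact: uM (rev01_itv s) (ta01 t).
have uC s t : cay (rev01 s) (V t) \is unitarymx.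
  exact: cay_unitary (rev01_itv s) (hV t) (uV t).
have c1 : continuous (fun x : R * R => rev01 x.1).
  by apply: rev01_continuous => x; exact: cvg_fst.
have c2 : continuous (fun x : R * R => ta x.2).
  apply: clamp_continuous => x; apply: cvgM; last exact: cvg_cst.
  by apply: cvgB; [exact: cvg_snd | exact: cvg_cst].
exists b, U; split.
- exact: ba.
- apply: mctsM.
    exact: (cM _ _ _ (fun x : R * R => rev01_itv x.1) (fun x => ta01 x.2) c1 c2).
  apply: (mcts_cay (fun x : R * R => rev01_itv x.1) (fun x : R * R => hV x.2) c1).
  apply: mctsM.
    apply: mcts_tC.
    have c3 : continuous (fun _ : R * R => 1 : R) by move=> x; exact: cvg_cst.
    exact: (cM _ _ _ (fun=> in01) (fun x : R * R => ta01 x.2) c3 c2).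
  apply: (@mcts_comp _ _ _ _ _ u (fun x : R * R => q x.2)) => //.
  by apply: clamp_continuous => x; exact: cvg_snd.
- by move=> s t; exact: mul_unitarymx (uMs s t) (uC s t).
- move=> A x x' s t d' tin hA hA' hAu.
  have cC0 : 0 <= cayC R n by rewrite /cayC addr_ge0 ?mulr_ge0 ?exprn_ge0.
  have cM1 := cmM0 A x x' d' (rev01 s) (ta t) (rev01_itv s) (ta01 t) hA hA'.
  have cM2 := cmM0 A x x' d' 1 (ta t) in01 (ta01 t) hA hA'.
  apply: le_trans (cmM _ (uMs s t) (uC s t)) _.
  rewrite /segCm -[leRHS]mulrA mulrDl; apply: (ler_wpM2l K0); apply: (lerD cM1).
  apply: le_trans (cm_cay _ (rev01_itv s) (hV t)) _.
  rewrite -[leRHS]mulrA; apply: (ler_wpM2l cC0).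
  apply: le_trans (cmM _ (unitary_tC (uM1 t)) (uu _)) _.
  rewrite -[leRHS]mulrA mulrDl mul1r; apply: (ler_wpM2l K0).
  rewrite /q clamp_id //; apply: (fun h => lerD h hAu).
  apply: le_trans (cm_tC _ (uM1 t)) _; rewrite -[leRHS]mulrA.
  by apply: ler_wpM2l cM2; exact: exprn_ge0.
split.
- move=> t tin; rewrite /U rev01_0 cay1 // /V mulmxA (unitarymxP (uM1 t)) mul1mx.
  by rewrite /q clamp_id.
- by move=> t tin; rewrite /U rev01_1 cay0 // mulmx1 M0.
- move=> s t tc; rewrite /U /V /q (tac t tc) (clamp_lo tc (ltW cc')).
  by rewrite (Mr0 _ (rev01_itv s)) (Mr0 _ in01); reflexivity.
- move=> s; rewrite /U /V /q tac' (clamp_id c'in).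
  by rewrite (Mr1 _ (rev01_itv s)) (Mr1 _ in01); reflexivity.
Qed.

Lemma expath_eq W a b : (forall k, cis (a k) = cis (b k)) -> expath W a 1 = expath W b 1.
Proof. by move=> ab; rewrite !expath1; congr dg; apply/funext. Qed.

Lemma contraction0 W a v : W \is unitarymx -> v \is unitarymx ->
  nrm ((expath W a 1)^t* *m v - 1%:M) <= 2^-1 -> contraction W a v 0 = 1%:M.
Proof. by move=> uW uv hv; rewrite /contraction expath0 // cay0 // mulmx1. Qed.

Lemma contraction1 W a v : W \is unitarymx -> v \is unitarymx ->
  nrm ((expath W a 1)^t* *m v - 1%:M) <= 2^-1 -> contraction W a v 1 = v.
Proof.
move=> uW uv hv; rewrite /contraction cay1 // mulmxA.
by rewrite (unitarymxP (expath_unitary a 1 uW)) mul1mx.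
Qed.

Lemma contraction_exact W a r : W \is unitarymx -> 0 <= r <= 1 ->
  contraction W a (expath W a 1) r = expath W a r.
Proof.
move=> uW r01; have uX := expath_unitary a 1 uW.
by rewrite /contraction (unitaryVm uX) (cay_id n r01) mulmx1.
Qed.

End Segment.

(** * Gluing the pieces *)

Section Chain.
Variables (R : realType) (n : nat).
Implicit Types (B W v : 'M[R[i]]_n) (a : 'I_n -> R) (r s t d : R).
Let K := unK R n.

Lemma small_near d W v : small n d -> 0 <= d -> W \is unitarymx ->
  nrm (v - W) <= d -> nrm (W^t* *m v - 1%:M) <= 2^-1.
Proof.
move=> /andP[_ sm] d0 uW hv; have K0 : 0 <= K by exact: unK_ge0.
apply: le_trans (near_unitary _ uW) _; apply: le_trans sm.
apply: (ler_wpM2l K0); apply: (le_trans hv); rewrite -[leLHS]mul1r.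
apply: (ler_wpM2r d0); rewrite /homK lerDl; have C0 := gapC_ge0 R (n + n).
rewrite /logK -/K; apply: mulr_ge0; first by apply: mulr_ge0 => //; exact: exprn_ge0.
by apply: mulr_ge0 => //; apply: mulr_ge0 => //; exact: exprn_ge0.
Qed.

Lemma cayC_ge0 : 0 <= cayC R n.
Proof.
have K0 : 0 <= K by exact: unK_ge0.
by apply: addr_ge0; [exact: mulr_ge0 | exact: exprn_ge0].
Qed.

(** Makes [segCm] valid also for a single [contraction], with which the chain starts. *)
Lemma homCm_ge : 2 * K <= homCm R n.
Proof.
have K0 : 0 <= K by exact: unK_ge0.
have K1 : 1 <= K by exact: unK_ge1.
have p0 : 0 <= prodC R n n by exact: prodC_ge0.
have c0 := cayC_ge0.
rewrite /homCm -/K; have K4 : 0 <= K ^+ 4 by exact: exprn_ge0.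
have t1 : 0 <= prodC R n n * (2 * (16 * K ^+ 4 * n.+1%:R)).
  by apply: mulr_ge0 => //; apply: mulr_ge0 => //; apply: mulr_ge0 => //; exact: mulr_ge0.
have t2 : 0 <= cayC R n * (K * (4 * K)).
  by apply: mulr_ge0 => //; apply: mulr_ge0 => //; exact: mulr_ge0.
move: (prodC R n n * _) (cayC R n * _) t1 t2 => x y x0 y0.
have h1 : 2 * K <= 2 * K + y by rewrite lerDl.
have h2 : 2 * K + y <= K * (2 * K + y).
  by rewrite -[leLHS]mul1r; apply: ler_wpM2r => //; rewrite addr_ge0 // mulr_ge0.
have h3 : K * (2 * K + y) + x <= K * (K * (2 * K + y) + x).
  rewrite -[leLHS]mul1r; apply: ler_wpM2r => //; rewrite addr_ge0 //.
  by rewrite mulr_ge0 // addr_ge0 // mulr_ge0.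
apply: le_trans h3; apply: (le_trans h1); apply: (le_trans h2); by rewrite lerDl.
Qed.

Lemma contraction_unitary W a v r : W \is unitarymx -> v \is unitarymx ->
  0 <= r <= 1 -> nrm ((expath W a 1)^t* *m v - 1%:M) <= 2^-1 ->
  contraction W a v r \is unitarymx.
Proof.
move=> uW uv r01 hv; have uX := expath_unitary a 1 uW.
apply: mul_unitarymx (expath_unitary a r uW) _.
exact: cay_unitary r01 hv (mul_unitarymx (unitary_tC uX) uv).
Qed.

Lemma cm_contraction W a v B x r d : W \is unitarymx -> v \is unitarymx ->
  0 <= r <= 1 -> nrm ((expath W a 1)^t* *m v - 1%:M) <= 2^-1 ->
  nrm (B - dg W x) <= d -> cm v B <= d ->
  cm (contraction W a v r) B <= segCm R n * d.
Proof.
move=> uW uv r01 hv hB hvB; have K0 : 0 <= K by exact: unK_ge0.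
have d0 : 0 <= d by exact: le_trans (nrm_ge0 _) hB.
have uX q := expath_unitary a q uW.
have cX q : cm (expath W a q) B <= homCm R n * d.
  apply: le_trans (cm_dg uW (uX q) hB) _; apply: (ler_wpM2r d0); exact: homCm_ge.
have uV := mul_unitarymx (unitary_tC (uX 1)) uv.
apply: le_trans (cmM _ (uX r) (cay_unitary r01 hv uV)) _.
rewrite /segCm -[leRHS]mulrA mulrDl; apply: (ler_wpM2l K0); apply: (lerD (cX r)).
apply: le_trans (cm_cay _ r01 hv) _.
rewrite -[leRHS]mulrA; apply: (ler_wpM2l cayC_ge0).
apply: le_trans (cmM _ (unitary_tC (uX 1)) uv) _.
rewrite -[leRHS]mulrA mulrDl mul1r; apply: (ler_wpM2l K0).
apply: (fun h => lerD h hvB).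
apply: le_trans (cm_tC _ (uX 1)) _; rewrite -[leRHS]mulrA.
by apply: (ler_wpM2l _ (cX 1)); exact: exprn_ge0.
Qed.

Variables (u : R -> 'M[R[i]]_n) (I : Type) (A : I -> R -> 'M[R[i]]_n).
Variables (N : nat) (W : nat -> 'M[R[i]]_n) (a : nat -> 'I_n -> R) (d : R).

Let node j : R := j%:R / N%:R.

Hypothesis N0 : (0 < N)%N.
Hypotheses (d0 : 0 <= d) (smd : small n d).
Hypotheses (cu : mcts u) (uu : forall t, u t \is unitarymx).
Hypothesis uW : forall j, W j \is unitarymx.
Hypothesis hu : forall j t, (j <= N)%N -> 0 <= t <= 1 -> `|t - node j| <= N%:R^-1 ->
  nrm (u t - expath (W j) (a j) 1) <= d.
Hypothesis hA : forall j i, (j <= N)%N -> exists x, forall t, 0 <= t <= 1 ->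
  `|t - node j| <= N%:R^-1 -> nrm (A i t - dg (W j) x) <= d.
Hypothesis hcm : forall i t, 0 <= t <= 1 -> cm (u t) (A i t) <= d.

(** Induction over the nodes. The branch [b] reached depends on all earlier pieces and only its
    [cis] is controlled, but [segment_path] asks for no more. *)
Lemma chain j : (j <= N)%N -> exists b (U : R -> R -> 'M[R[i]]_n),
  [/\ forall l, cis (b l) = cis (a j l),
      mcts (fun x : R * R => U x.1 x.2),
      forall s t, U s t \is unitarymx,
      forall s t i, 0 <= t <= node j -> cm (U s t) (A i t) <= segCm R n * d &
      [/\ forall t, 0 <= t <= node j -> U 0 t = u t,
          forall t, 0 <= t <= node j -> U 1 t = 1%:M,
          forall s, U s 0 = contraction (W 0) (a 0) (u 0) (rev01 s) &
          forall s, U s (node j) = contraction (W j) b (u (node j)) (rev01 s)]].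
Proof.
have NR : 0 < N%:R :> R by rewrite ltr0n.
have Ni : 0 < N%:R^-1 :> R by rewrite invr_gt0.
have node0 : node 0 = 0 by rewrite /node mul0r.
have node01 k : (k <= N)%N -> 0 <= node k <= 1.
  by move=> kN; rewrite /node divr_ge0 //= ler_pdivrMr // mul1r ler_nat.
have in0 : 0 <= (0 : R) <= 1 by rewrite lexx ler01.
elim: j => [_|j IH jN].
  have h0 : nrm ((expath (W 0) (a 0) 1)^t* *m u 0 - 1%:M) <= 2^-1.
    apply: (small_near smd d0 (expath_unitary _ _ (uW 0))).
    by apply: hu => //; rewrite node0 subrr normr0 ltW.
  have z t : 0 <= t <= node 0 -> t = 0.
    by rewrite node0 => h; apply/eqP; rewrite eq_le andbC.
  exists (a 0), (fun s _ => contraction (W 0) (a 0) (u 0) (rev01 s)); split.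
  - by [].
  - have cf : continuous (fun x : R * R => rev01 x.1).
      by apply: rev01_continuous => x; exact: cvg_fst.
    apply: mctsM; first exact: mcts_expath.
    by apply: mcts_cay => //; [move=> x; exact: rev01_itv | exact: mcts_cst].
  - by move=> s t; apply: contraction_unitary (uW 0) (uu 0) (rev01_itv s) h0.
  - move=> s t i /z ->; have [x hx] := hA i (leq0n N).
    apply: cm_contraction (uW 0) (uu 0) (rev01_itv s) h0 (hx 0 in0 _) (hcm i in0).
    by rewrite node0 subrr normr0 ltW.
  split.
  - by move=> t /z ->; rewrite rev01_0 contraction1.
  - by move=> t _; rewrite rev01_1 contraction0.
  - by [].
  - by move=> s; rewrite node0.
have [b [U [ba cU uU cmU [U0 U1 Us0 Usj]]]] := IH (ltnW jN).
set c := node j in cmU U0 U1 Usj; set c' := node j.+1.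
have c'E : c' = c + N%:R^-1 by rewrite /c' /c /node -natr1 mulrDl mul1r.
have cc' : c < c' by rewrite c'E ltrDl.
have [c0 _] := andP (node01 j (ltnW jN)); have [_ c1] := andP (node01 j.+1 jN).
have in01 t : c <= t <= c' -> 0 <= t <= 1.
  by move=> /andP[h1 h2]; rewrite (le_trans c0 h1) (le_trans h2 c1).
have nearc t : c <= t <= c' -> `|t - c| <= N%:R^-1.
  by move=> /andP[h1 h2]; rewrite ger0_norm ?subr_ge0 // lerBlDl -c'E.
have nearc' t : c <= t <= c' -> `|t - c'| <= N%:R^-1.
  move=> /andP[h1 h2]; rewrite distrC ger0_norm ?subr_ge0 //.
  by rewrite lerBlDl c'E lerD2r.
have cin : c <= c <= c' by rewrite lexx ltW.
have hb t : c <= t <= c' -> nrm (u t - expath (W j) b 1) <= d.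
  by move=> tin; rewrite (expath_eq (W j) ba); exact: hu (ltnW jN) (in01 t tin) (nearc t tin).
have hb' t : c <= t <= c' -> nrm (u t - expath (W j.+1) (a j.+1) 1) <= d.
  by move=> tin; exact: hu jN (in01 t tin) (nearc' t tin).
have [b' [V [ba' cV uV cmV [V0 V1 Vc Vc']]]] :=
  segment_path (uW j) (uW j.+1) smd cc' cu uu hb hb'.
have VU s t : t <= c -> V s t = U s c by move=> tc; rewrite Vc // Usj.
(* One product glues both pieces, so joint continuity needs no cases: left of [c] the last two
   factors cancel, right of [c] the first two. *)
pose U' s t := U s (Num.min t c) *m (U s c)^t* *m V s t.
have U'l s t : t <= c -> U' s t = U s t.
  move=> tc; rewrite /U' (VU s t tc) (min_idPl tc) -mulmxA (unitaryVm (uU s c)).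
  by rewrite mulmx1.
have U'r s t : c <= t -> U' s t = V s t.
  move=> ct; rewrite /U' (min_idPr ct) (unitarymxP (uU s c)).
  by rewrite mul1mx.
have cut t : 0 <= t <= c' -> (0 <= t <= c) \/ (c <= t <= c').
  move=> /andP[h1 h2]; have [h|/ltW h] := leP t c; [left|right]; first by rewrite h1.
  by rewrite h.
exists b', U'; split.
- exact: ba'.
- have c1m : continuous (fun x : R * R => (x.1, Num.min x.2 c)).
    move=> x; apply: (@cvg_pair _ _ _ (nbhs x) (nbhs x.1) (nbhs (Num.min x.2 c)) _ _ _
      (fun y : R * R => y.1) (fun y => Num.min y.2 c)); first exact: cvg_fst.
    by apply: (@continuous_min R _ (fun x : R * R => x.2) (cst c)); [exact: cvg_snd | exact: cvg_cst].
  have c1c : continuous (fun x : R * R => (x.1, c)).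
    move=> x; apply: (@cvg_pair _ _ _ (nbhs x) (nbhs x.1) (nbhs c) _ _ _
      (fun y : R * R => y.1) (fun=> c)); [exact: cvg_fst | exact: cvg_cst].
  apply: mctsM => //; apply: mctsM; last apply: mcts_tC.
    exact: (mcts_comp c1m cU).
  exact: (mcts_comp c1c cU).
- move=> s t; apply: mul_unitarymx (uV s t).
  exact: mul_unitarymx (uU s _) (unitary_tC (uU s c)).
- move=> s t i /cut[tin|tin].
    have [_ tc] := andP tin; rewrite (U'l s t tc); exact: cmU.
  have [ct _] := andP tin; rewrite (U'r s t ct).
  have [x hx] := hA i (ltnW jN); have [x' hx'] := hA i jN.
  exact: (cmV _ _ _ _ _ _ tin (hx t (in01 t tin) (nearc t tin))
    (hx' t (in01 t tin) (nearc' t tin)) (hcm i (in01 t tin))).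
split.
- move=> t /cut[tin|tin].
    have [_ tc] := andP tin; rewrite (U'l _ t tc); exact: U0.
  have [ct _] := andP tin; rewrite (U'r _ t ct); exact: V0.
- move=> t /cut[tin|tin].
    have [_ tc] := andP tin; rewrite (U'l _ t tc); exact: U1.
  have [ct _] := andP tin; rewrite (U'r _ t ct); exact: V1.
- by move=> s; rewrite (U'l s 0 c0); exact: Us0.
- by move=> s; rewrite (U'r s c' (ltW cc')); exact: Vc'.
Qed.

End Chain.

(** * Comparison with the operator norm and the entrywise topology *)

Section Interface.
Variables (R : realType) (n : nat).

Lemma cvg_ccts (T : topologicalType) (g : T -> Cplx R) (p : T) :
  g q @[q --> p] --> g p <-> nc (g q - g p) @[q --> p] --> (0 : R).
Proof.
split.
  move=> /cvgrPdist_lt h; apply/cvgrPdist_lt => e e0.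
  have e0' : 0 < (e%:C : Cplx R) by rewrite ltcR.
  apply: filterS (h _ e0') => q; rewrite sub0r normrN (ger0_norm (nc_ge0 _)).
  by rewrite distrC -nc_norm ltcR.
move=> /cvgrPdist_lt h; apply/cvgrPdist_lt => e e0.
have eE : e = (complex.Re e)%:C.
  by case: e e0 => x y; rewrite ltcE /= => /andP[/eqP -> _].
have e0' : 0 < complex.Re e by rewrite -ltcR -eE.
apply: filterS (h _ e0') => q; rewrite sub0r normrN (ger0_norm (nc_ge0 _)).
by rewrite eE distrC -nc_norm ltcR.
Qed.

Lemma mcts_continuous (T : topologicalType) m (f : T -> 'M[Cplx R]_(m, n)) :
  mcts f -> continuous f.
Proof.
move=> cf p A [P fP PA]; apply: (filterS (fun q => PA (f q))).
apply: filter_forall => i; apply: filter_forall => j.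
have : (fun q => f q i j) q @[q --> p] --> f p i j.
  apply/cvg_ccts; apply: squeeze0 (cf p) => q; rewrite nc_ge0 /=.
  by apply: le_trans (entry_le_nrm _ i j); rewrite !mxE.
by apply; exact: fP.
Qed.

Lemma continuous_mcts (T : topologicalType) m (f : T -> 'M[Cplx R]_(m, n)) :
  continuous f -> mcts f.
Proof.
move=> cf; apply: mcts_entries => i j p.
apply/(@cvg_ccts T (fun q => f q i j)) => B fB.
apply: (cf p [set M : 'M[Cplx R]_(m, n) | B (M i j)]).
(* A basic neighbourhood that constrains the entry [(i, j)] only. *)
exists (fun i' j' => [set z | i' = i -> j' = j -> B z]) => [i' j'|M]; last exact.
have [->|ne] := eqVneq i' i; last by apply: filterS filterT => z _ /eqP; rewrite (negbTE ne).
have [->|ne] := eqVneq j' j; last by apply: filterS filterT => z _ _ /eqP; rewrite (negbTE ne).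
by apply: filterS fB => z Bz _ _.
Qed.

Lemma l2norm_le_sum (v : 'cV[Cplx R]_n) : l2norm v <= \sum_i nc (v i 0).
Proof.
rewrite /l2norm.
have s0 : 0 <= \sum_i nc (v i 0) by apply: sumr_ge0 => i _; exact: nc_ge0.
rewrite -[leRHS]ger0_norm // -sqrtr_sqr; apply: ler_wsqrtr.
rewrite expr2 mulr_suml; apply: ler_sum => i _; rewrite expr2.
apply: ler_wpM2l; first exact: nc_ge0.
by rewrite (bigD1 i) //= lerDl; apply: sumr_ge0 => j _; exact: nc_ge0.
Qed.

Lemma entry_le_l2norm (v : 'cV[Cplx R]_n) i : nc (v i 0) <= l2norm v.
Proof.
rewrite /l2norm -[leLHS]ger0_norm ?nc_ge0 // -sqrtr_sqr; apply: ler_wsqrtr.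
by rewrite (bigD1 i) //= lerDl; apply: sumr_ge0 => j _; exact: sqr_ge0.
Qed.

Lemma l2norm_mul_le (A : 'M[Cplx R]_n) (v : 'cV[Cplx R]_n) :
  l2norm v <= 1 -> l2norm (A *m v) <= nrm A.
Proof.
move=> v1; apply: le_trans (l2norm_le_sum _) _; rewrite nrm.unlock.
apply: ler_sum => i _; rewrite mxE; apply: le_trans (nc_sum _ _ _) _.
apply: ler_sum => j _; rewrite ncM -[leRHS]mulr1; apply: ler_wpM2l.
  exact: nc_ge0.
exact: le_trans (entry_le_l2norm v j) v1.
Qed.

Let ball_image (A : 'M[Cplx R]_n) := [set l2norm (A *m v) | v in [set v | l2norm v <= 1]].

Let ball_image_ubound A : ubound (ball_image A) (nrm A).
Proof. by move=> _ [v v1 <-]; exact: l2norm_mul_le. Qed.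

Lemma opnorm_le_nrm (A : 'M[Cplx R]_n) : opnorm A <= nrm A.
Proof.
apply: ge_sup; last exact: ball_image_ubound.
exists (l2norm (A *m 0)), 0 => //=.
rewrite /l2norm big1 ?sqrtr0 ?ler01 // => i _.
by rewrite mxE nc0 expr0n.
Qed.

Lemma opnorm_ge0 (A : 'M[Cplx R]_n) : 0 <= opnorm A.
Proof.
apply: (@le_trans _ _ (l2norm (A *m 0))); first exact: sqrtr_ge0.
apply: sup_upper_bound; last first.
  exists 0 => //=; rewrite /l2norm big1 ?sqrtr0 ?ler01 // => i _.
  by rewrite mxE nc0 expr0n.
split; last by exists (nrm A); exact: ball_image_ubound.
exists (l2norm (A *m 0)), 0 => //=; rewrite /l2norm big1 ?sqrtr0 ?ler01 // => i _.
by rewrite mxE nc0 expr0n.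
Qed.

Lemma entry_le_opnorm (A : 'M[Cplx R]_n) i j : nc (A i j) <= opnorm A.
Proof.
pose v : 'cV[Cplx R]_n := delta_mx j 0.
have v1 : l2norm v <= 1.
  rewrite /l2norm (bigD1 j) //= mxE !eqxx nc1 expr1n big1 ?addr0 ?sqrtr1 // => k kj.
  by rewrite mxE (negbTE kj) nc0 expr0n.
apply: (@le_trans _ _ (l2norm (A *m v))).
  by apply: le_trans (entry_le_l2norm _ i); rewrite -colE mxE.
apply: sup_upper_bound; last by exists v.
split; last by exists (nrm A); exact: ball_image_ubound.
by exists (l2norm (A *m v)), v.
Qed.

Lemma supnorm_le (f : unit_itv R -> 'M[Cplx R]_n) (c : R) :
  (forall t, nrm (f t) <= c) -> supnorm f <= c.
Proof.
move=> h; apply: ge_sup; first by exists (opnorm (f (itv0 R))), (itv0 R).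
by move=> _ [t _ <-]; exact: le_trans (opnorm_le_nrm _) (h t).
Qed.

(** The bound [c] ensures that [sup] is a genuine supremum; entries are at most the operator norm,
    and [unK] dominates their number. *)
Lemma nrm_le_supnorm (f : unit_itv R -> 'M[Cplx R]_n) (c : R) t :
  (forall t, nrm (f t) <= c) -> nrm (f t) <= unK R n * supnorm f.
Proof.
move=> h; have sup_ge : opnorm (f t) <= supnorm f.
  apply: sup_upper_bound; last by exists t.
  split; first by exists (opnorm (f t)), t.
  by exists c => _ [q _ <-]; exact: le_trans (opnorm_le_nrm _) (h q).
apply: nrm_le_unK; first exact: le_trans (opnorm_ge0 _) sup_ge.
by move=> i j; exact: le_trans (entry_le_opnorm _ i j) sup_ge.
Qed.

End Interface.

(** * Uniformity over the compact interval *)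

Section UnitInterval.
Variables (R : realType) (n : nat).
Implicit Types f : R -> 'M[R[i]]_n.

Lemma mcts_near (T : topologicalType) m p (f : T -> 'M[R[i]]_(m, p)) x (e : R) :
  mcts f -> 0 < e -> \forall y \near x, nrm (f y - f x) < e.
Proof.
move=> cf e0; have /cvgrPdist_lt /(_ e e0) := cf x.
by apply: filterS => y; rewrite sub0r normrN (ger0_norm (nrm_ge0 _)).
Qed.

Lemma unif_cts f (e : R) : mcts f -> 0 < e -> \forall N \near \oo,
  forall t t', 0 <= t <= 1 -> `|t' - t| <= N.+1%:R^-1 -> nrm (f t' - f t) <= e.
Proof.
move=> cf e0; have e2 : 0 < e / 2 by rewrite divr_gt0.
have /compact_near_coveringP/(_ nat \oo (fun N t => forall t' : R,
  `|t' - t| <= N.+1%:R^-1 -> nrm (f t' - f t) <= e)) := @segment_compact R 0 1.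
case=> [x _|N0 _ hN]; last first.
  exists N0 => // N /hN h t t' t01 tt'.
  by apply: h => //=; rewrite in_itv.
have /nbhs_ballP [d /= d0 hd] := mcts_near x cf e2.
have d2 : 0 < d / 2 by rewrite divr_gt0.
near=> y N => t' hy.
have hyx : `|y - x| < d / 2 by near: y; apply: cvgr_distC_lt => //; exact: cvg_id.
have hN : N.+1%:R^-1 < d / 2 by near: N; exact: (near_infty_natSinv_lt (PosNum d2)).
apply: le_trans (nrm_trans (f x) _ _) _; rewrite [nrm (f x - _)]nrmC.
have -> : e = e / 2 + e / 2 by lra.
apply: lerD; apply/ltW/hd; rewrite /ball /= distrC; last by lra.
have -> : t' - x = (t' - y) + (y - x) by rewrite addrA subrK.
apply: le_lt_trans (ler_normD _ _) _; have hty : `|t' - y| < d / 2 := le_lt_trans hy hN.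
by rewrite [ltRHS]splitr ltrD.
Unshelve. all: by end_near. Qed.

Lemma bounded_on_unit f : mcts f -> exists c : R, forall t, 0 <= t <= 1 -> nrm (f t) <= c.
Proof.
move=> cf; have /compact_near_coveringP/(_ nat \oo (fun N t => nrm (f t) <= N%:R)) :=
  @segment_compact R 0 1.
case=> [x _|N0 _ hN]; last first.
  by exists N0%:R => t t01; apply: (hN N0 (leqnn _)) => /=; rewrite in_itv.
near=> y N.
have h1 : nrm (f y - f x) < 1 by near: y; exact: (mcts_near x cf ltr01).
have h2 : nrm (f x) + 1 <= N%:R by near: N; exact: nbhs_infty_ger.
apply: le_trans h2; have := nrmD (f y - f x) (f x); rewrite subrK => h.
by apply: le_trans h _; rewrite [leRHS]addrC lerD2r ltW.
Unshelve. all: by end_near. Qed.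

(** Tube argument: joint continuity near the points [(s, x)] and compactness in [x] give one
    neighbourhood of [s]; this is continuity in the supremum norm. *)
Lemma unif_near (U : R -> R -> 'M[R[i]]_n) (e s : R) :
  mcts (fun x : R * R => U x.1 x.2) -> 0 < e ->
  \forall s' \near s, forall t, 0 <= t <= 1 -> nrm (U s' t - U s t) <= e.
Proof.
move=> cU e0; have e2 : 0 < e / 2 by rewrite divr_gt0.
have /compact_near_coveringP/(_ R (nbhs s) (fun s' t => nrm (U s' t - U s t) <= e)) :=
  @segment_compact R 0 1.
move=> H; apply: filterS (H (nbhs_filter s) _) => [s' h t t01|x _].
  by apply: h => /=; rewrite in_itv.
have [[P Q] /= [nP nQ] PQ] := mcts_near (s, x) cU e2.
exists (Q, P) => //= -[y s'] /= [Qy Ps'].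
apply: le_trans (nrm_trans (U s x) _ _) _; rewrite [nrm (U s x - _)]nrmC.
have -> : e = e / 2 + e / 2 by lra.
apply: lerD; apply/ltW; first by exact: (PQ (s', y)).
by apply: (PQ (s, y)); split => //=; exact: nbhs_singleton nP.
Qed.

Lemma clamp01_unit (t : R) : clamp 0 1 t \in `[0, 1]%classic.
Proof. by rewrite inE /= in_itv /=; exact: clamp_itv ler01. Qed.

(** The retraction of the line onto the interval; composing with it extends [u] and [phi f] to the
    line, where the pieces are built. *)
Definition to_unit (t : R) : unit_itv R := SigSub (clamp01_unit t).

Lemma unit_itvP (t : unit_itv R) : 0 <= val t <= 1.
Proof. by case: t => t /= /set_mem /=; rewrite in_itv. Qed.

Lemma to_unit_continuous : continuous to_unit.
Proof.
apply: continuous_comp_initial => t.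
exact: (@clamp_continuous R 0 1 R id (fun x => cvg_id)).
Qed.

Lemma to_unit_val (t : unit_itv R) : to_unit (val t) = t.
Proof. by apply: val_inj => /=; rewrite clamp_id // unit_itvP. Qed.

Lemma val_unit_continuous : continuous (fun t : unit_itv R => val t).
Proof. exact: initial_continuous. Qed.

Lemma to_unit0 : to_unit 0 = itv0 R.
Proof. exact: (to_unit_val (itv0 R)). Qed.

Lemma to_unit1 : to_unit 1 = itv1 R.
Proof. exact: (to_unit_val (itv1 R)). Qed.

End UnitInterval.

(** * Choice of the constants and assembly *)

Section Assembly.
Variables (R : realType) (n : nat).

Lemma small_exists (e : R) : 0 < e ->
  exists2 d : R, 0 < d & small n d /\ segCm R n * d <= e.
Proof.
move=> e0; have K0 : 0 <= unK R n by exact: unK_ge0.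
have l0 : 0 <= logK R n.
  apply: mulr_ge0 => //; apply: mulr_ge0; first exact: gapC_ge0.
  exact: exprn_ge0.
have m0 : 0 <= homK R n.
  apply: addr_ge0 => //; apply: mulr_ge0 => //; apply: mulr_ge0 => //.
  exact: exprn_ge0.
have h0 : 0 <= homCm R n by apply: le_trans (homCm_ge R n); exact: mulr_ge0.
have s0 : 0 <= segCm R n.
  apply: mulr_ge0 => //; apply: addr_ge0 => //; apply: mulr_ge0; first exact: cayC_ge0.
  apply: mulr_ge0 => //; apply: addr_ge0 => //; apply: mulr_ge0 => //; exact: exprn_ge0.
(* Dominates the three coefficients that have to be made small; 1 keeps it positive. *)
pose B := 1 + unK R n * logK R n + unK R n * homK R n + segCm R n.
have kl0 : 0 <= unK R n * logK R n by exact: mulr_ge0.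
have kh0 : 0 <= unK R n * homK R n by exact: mulr_ge0.
have B0 : 0 < B by rewrite /B; lra.
pose x := Num.min e 2^-1; have x0 : 0 < x by rewrite lt_min e0 invr_gt0 ltr0n.
have key y : y <= B -> y * (x / B) <= x.
  by move=> yB; rewrite mulrCA ger_pMr // ler_pdivrMr // mul1r.
have xe : x <= e by rewrite ge_min lexx.
have x2 : x <= 2^-1 by rewrite ge_min lexx orbT.
exists (x / B); first exact: divr_gt0.
split; last by apply: le_trans xe; apply: key; rewrite /B; lra.
by apply/andP; split; rewrite mulrA; apply: le_trans x2; apply: key; rewrite /B; lra.
Qed.

Variable X : topologicalType.

Lemma CX_mulC (f g : CX R X) : CX_mul f g = CX_mul g f.
Proof. by apply/continuousEP => x; exact: mulrC. Qed.

Lemma star_hom_comm (phi : CX R X -> CIM R n) f g t : unital_star_hom phi ->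
  phi f t *m phi g t = phi g t *m phi f t.
Proof. by move=> h; rewrite -!(hom_mul h) CX_mulC. Qed.

Lemma unif_cts_finite (F : set (CX R X)) (A : CX R X -> R -> 'M[R[i]]_n) (e : R) :
  finite_set F -> (forall f, mcts (A f)) -> 0 < e ->
  \forall N \near \oo, forall f, F f -> forall t t', 0 <= t <= 1 ->
    `|t' - t| <= N.+1%:R^-1 -> nrm (A f t' - A f t) <= e.
Proof.
move=> /finite_seqP [s ->] cA e0; elim: s => [|g s IH].
  by apply: filterS filterT => N _ f.
have h := unif_cts (cA g) e0; near=> N => f /=; rewrite inE => /orP[/eqP ->|fs].
  by near: N; exact: h.
by move: f fs; near: N; exact: IH.
Unshelve. all: by end_near. Qed.

(** [delta] serves twice: below [delta0] it yields the bases, below [d] it bounds the commutators of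
    [u] itself along the chain. The number of nodes is chosen after [phi] and [u]. *)
Lemma approximate_path (e : R) : 0 < e -> exists2 delta : R, 0 < delta &
  forall (F : set (CX R X)) (phi : CX R X -> CIM R n) (u : CIM R n),
  finite_set F -> unital_star_hom phi -> unitary_fun u ->
  (forall f, F f -> forall t, cm (u t) (phi f t) <= delta) ->
  exists U : R -> R -> 'M[R[i]]_n,
  [/\ mcts (fun x : R * R => U x.1 x.2),
      forall s t, U s t \is unitarymx,
      forall t : unit_itv R, U 0 (val t) = u t,
      forall t : unit_itv R, U 1 (val t) = 1%:M &
      forall f, F f -> forall s (t : unit_itv R), cm (U s (val t)) (phi f t) <= e]
  /\ ((forall f, u (itv0 R) *m phi f (itv0 R) = phi f (itv0 R) *m u (itv0 R)) ->
      forall f s, U s 0 *m phi f (itv0 R) = phi f (itv0 R) *m U s 0)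
  /\ ((forall f, u (itv1 R) *m phi f (itv1 R) = phi f (itv1 R) *m u (itv1 R)) ->
      forall f s, U s 1 *m phi f (itv1 R) = phi f (itv1 R) *m U s 1).
Proof.
move=> e0; have [d d0 [smd hd]] := small_exists e0.
(* One half is for the diagonalization at a node, the other for the oscillation of [u] and [phi f]
   around it. *)
have d2 : 0 < d / 2 by rewrite divr_gt0.
have [delta0 delta00 hdelta] := @approximate_codiag R n (d / 2) d2.
exists (Num.min delta0 d); first by rewrite lt_min delta00.
move=> F phi u finF hphi uu hcm.
pose ur t : 'M[R[i]]_n := u (to_unit t).
pose A (f : CX R X) t : 'M[R[i]]_n := phi f (to_unit t).
have cur : mcts ur.
  have cu : mcts (u : unit_itv R -> 'M[R[i]]_n) by apply: continuous_mcts; exact: cts_fun.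
  exact: (mcts_comp (@to_unit_continuous R) cu).
have cA f : mcts (A f).
  have cf : mcts (phi f : unit_itv R -> 'M[R[i]]_n).
    by apply: continuous_mcts; exact: cts_fun.
  exact: (mcts_comp (@to_unit_continuous R) cf).
(* The family diagonalized holds the values of all [f], not only of those in [F], because the
   conditions at the ends concern all of [C(X)]. *)
have /choice [W] : forall t : R, exists W : 'M[R[i]]_n, exists a : 'I_n -> R,
   [/\ W \is unitarymx, nrm (ur t - dg W (fun k => cis (a k))) <= d / 2,
    forall f, F f -> exists x, nrm (A f t - dg W x) <= d / 2 &
    (forall f, ur t *m A f t = A f t *m ur t) ->
     ur t = dg W (fun k => cis (a k)) /\ forall f, exists x, A f t = dg W x].
  move=> t.
  have [||B C|||W [a [uW hW hA hex]]] := hdelta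
    [set B | exists f, B = A f t] [set B | exists2 f, F f & B = A f t] (ur t).
  - exact: uu.
  - by move=> B [f _ ->]; exists f.
  - by move=> [f ->] [g ->]; exact: star_hom_comm.
  - by move=> B [f ->]; exists (CX_conj f); rewrite /A (hom_star hphi).
  - move=> B [f Ff ->]; apply: le_trans (hcm f Ff (to_unit t)) _.
    by rewrite ge_min lexx.
  exists W, a; split => //.
  - by move=> f Ff; apply: hA; exists f.
  - move=> h; have [|h1 h2] := hex; first by move=> B [f ->]; exact: h.
    by split => // f; apply: h2; exists f.
move=> /choice [a Wa].
have hN1 := unif_cts cur d2; have hN2 := unif_cts_finite finF cA d2.
have [N [hNu hNA]] : exists N, (forall t t', 0 <= t <= 1 ->
    `|t' - t| <= N.+1%:R^-1 -> nrm (ur t' - ur t) <= d / 2) /\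
  (forall f, F f -> forall t t', 0 <= t <= 1 ->
    `|t' - t| <= N.+1%:R^-1 -> nrm (A f t' - A f t) <= d / 2).
  by have [N [h1 h2]] := filter_ex (filterI hN1 hN2); exists N.
pose node (j : nat) : R := j%:R / N.+1%:R.
have node01 j : (j <= N.+1)%N -> 0 <= node j <= 1.
  by move=> jN; rewrite /node divr_ge0 //= ler_pdivrMr ?ltr0n // mul1r ler_nat.
have node0 : node 0 = 0 by rewrite /node mul0r.
have node1 : node N.+1 = 1 by rewrite /node divff // pnatr_eq0.
have dd : d = d / 2 + d / 2 by rewrite -splitr.
have [||||b [U [ba cU uU cmU [U0 U1 Us0 Us1]]]] := @chain R n ur {f : CX R X | F f}
  (fun f => A (sval f)) N.+1 (fun j => W (node j)) (fun j => a (node j)) d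
  isT (ltW d0) smd cur (fun t => uu (to_unit t)) _ _ _ _ N.+1 (leqnn _).
- by move=> j; have [] := Wa (node j).
- move=> j t jN t01 tj; have [_ h _ _] := Wa (node j).
  apply: le_trans (nrm_trans (ur (node j)) _ _) _; rewrite [leRHS]dd expath1.
  by apply: lerD h; apply: hNu => //; exact: node01.
- move=> j [f Ff] jN; have [_ _ /(_ f Ff) [x hx] _] := Wa (node j).
  exists x => t t01 tj /=.
  apply: le_trans (nrm_trans (A f (node j)) _ _) _; rewrite [leRHS]dd.
  by apply: lerD hx; apply: hNA => //; exact: node01.
- move=> [f Ff] t _ /=; apply: le_trans (hcm f Ff (to_unit t)) _.
  by rewrite ge_min lexx orbT.
have valN (t : unit_itv R) : 0 <= val t <= node N.+1 by rewrite node1; exact: unit_itvP.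
exists U; split; [split|split].
- exact: cU.
- exact: uU.
- by move=> t; rewrite U0 // /ur to_unit_val.
- by move=> t; rewrite U1.
- move=> f Ff s t; have := cmU s (val t) (exist _ f Ff) (valN t).
  by rewrite /A /= to_unit_val => h; exact: le_trans h hd.
(* Here [u] is exactly the exponential, so the contraction reduces to [expath], diagonal in a basis
   that diagonalizes every [phi f]. *)
- move=> h0 f s; have [uW _ _ hex] := Wa (node 0).
  have [|hu hA] := hex; first by move=> g; rewrite node0 /ur /A to_unit0; exact: h0.
  have {}hA := hA f; rewrite Us0; move: hu hA.
  rewrite -expath1 node0 => ->; rewrite /A to_unit0 => -[x ->].
  rewrite node0 in uW.
  rewrite (contraction_exact _ uW (rev01_itv s)) /expath (dgM _ _ uW) (dgM _ _ uW).
  by congr dg; apply/funext => k; exact: mulrC.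
- move=> h1 f s; have [uW _ _ hex] := Wa (node N.+1).
  have [|hu hA] := hex; first by move=> g; rewrite node1 /ur /A to_unit1; exact: h1.
  have Us1' : U s 1 = expath (W (node N.+1)) b (rev01 s).
    have e1 : U s (node N.+1) = contraction (W (node N.+1)) b (ur (node N.+1)) (rev01 s).
      exact: Us1 s.
    rewrite hu -expath1 -(expath_eq _ ba) in e1.
    by rewrite (contraction_exact _ uW (rev01_itv s)) node1 in e1 *.
  have := hA f; rewrite Us1' /A node1 to_unit1 => -[x ->].
  rewrite node1 in uW; rewrite /expath (dgM _ _ uW) (dgM _ _ uW).
  by congr dg; apply/funext => k; exact: mulrC.
Qed.

End Assembly.

(* From matrix paths over the line to paths in [C([0,1], M_n)] *)
Local Close Scope sesquilinear_scope.
Local Close Scope complex_scope.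

Theorem lemma5p2 (R : realType) (X : metricType R) (compactX : compact [set: X])
    (n : nat) (n_ge1 : (1 <= n)%N)
    (eps : R) (eps_gt0 : 0 < eps) (F : set (CX R X)) (finF : finite_set F) :
  exists (G : set (CX R X)) (delta : R),
    [/\ finite_set G, 0 < delta &
    forall (phi : CX R X -> CIM R n) (u : CIM R n),
      unital_star_hom phi -> unitary_fun u ->
      (forall g, G g -> supnorm (commf u (phi g)) < delta) ->
      exists U : unit_itv R -> CIM R n,
        [/\ norm_cts_path U,
            forall s, unitary_fun (U s),
            U (itv0 R) = u,
            forall t, U (itv1 R) t = 1%:M &
            forall f, F f -> forall s, supnorm (commf (U s) (phi f)) < eps]
        /\ ((forall f, u (itv0 R) *m phi f (itv0 R)
                       = phi f (itv0 R) *m u (itv0 R)) ->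
            forall f s, U s (itv0 R) *m phi f (itv0 R)
                        = phi f (itv0 R) *m U s (itv0 R))
        /\ ((forall f, u (itv1 R) *m phi f (itv1 R)
                       = phi f (itv1 R) *m u (itv1 R)) ->
            forall f s, U s (itv1 R) *m phi f (itv1 R)
                        = phi f (itv1 R) *m U s (itv1 R))].
Proof.
(* Pointwise bounds give only weak inequalities for suprema; the half restores strictness. *)
have e2 : 0 < eps / 2 by rewrite divr_gt0.
have [delta delta0 hdelta] := approximate_path n X e2.
have K0 : 0 < unK R n by exact: lt_le_trans ltr01 (unK_ge1 R n).
(* [F] itself serves as [G]; dividing by [unK] accounts for the passage from the operator norm to
   [nrm]. *)
exists F, (delta / unK R n); split => //; first exact: divr_gt0.
move=> phi u hphi uu hG.
have [|U [[cU uU U0 U1 cmU] [Ul Ur]]] := hdelta F phi u finF hphi uu.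
  move=> f Ff t.
  have cc : mcts (fun t => commf u (phi f) t).
    have cu : mcts (u : unit_itv R -> 'M[R[i]]_n) by apply: continuous_mcts; exact: cts_fun.
    have cf : mcts (phi f : unit_itv R -> 'M[R[i]]_n) by apply: continuous_mcts; exact: cts_fun.
    by apply: mctsD; [exact: mctsM | apply: mctsN; exact: mctsM].
  have [c hc] := bounded_on_unit (mcts_comp (@to_unit_continuous R) cc).
  have hc' q : nrm (commf u (phi f) q) <= c.
    by rewrite -(to_unit_val q); apply: hc; exact: unit_itvP.
  apply: le_trans (nrm_le_supnorm t hc') _; rewrite mulrC -ler_pdivlMr //.
  exact/ltW/hG.
have cUs (s : unit_itv R) : continuous (fun t : unit_itv R => U (val s) (val t) : 'M[Cplx R]_n).
  apply: mcts_continuous; apply: (@mcts_comp R _ _ _ _ _ (fun t : unit_itv R => (val s, val t)) _ cU).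
  move=> t; apply: (@cvg_pair _ _ _ (nbhs t) (nbhs (val s)) (nbhs (val t)) _ _ _
      (fun=> val s) (fun t : unit_itv R => val t)); first exact: cvg_cst.
  exact: val_unit_continuous.
exists (fun s => mkcts (cUs s)); split; [split|split].
- move=> s e e0; have e20 : 0 < e / 2 by rewrite divr_gt0.
  have h : \forall s' \near s, forall t, 0 <= t <= 1 ->
      nrm (U (val s') t - U (val s) t) <= e / 2.
    exact: (val_unit_continuous (unif_near (val s) cU e20)).
  apply: (filterS _ h) => s' hs'; apply: (@le_lt_trans _ _ (e / 2)).
    by apply: supnorm_le => t; exact: (hs' (val t) (unit_itvP t)).
  by rewrite ltr_pdivrMr // ltr_pMr // ltr1n.
- by move=> s t; exact: uU.
- by apply/continuousEP => t; exact: U0.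
- by move=> t; exact: U1.
- move=> f Ff s; apply: (@le_lt_trans _ _ (eps / 2)).
    by apply: supnorm_le => t; exact: cmU.
  by rewrite ltr_pdivrMr // ltr_pMr // ltr1n.
- by move=> h f s; exact: Ul.
- by move=> h f s; exact: Ur.
Qed.
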